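(* Let $\Gamma$ and $\Lambda$ be countable, locally finite groups with proper left-invariant metrics $d_\Gamma$ and $d_\Lambda$ respectively. Then the following conditions are equivalent: \begin{enumerate} \item[(1)] $(\Gamma,d_\Gamma)$ and $(\Lambda,d_\Lambda)$ are coarsely equivalent. \item[(2)] $K_0(B^p_u(\Gamma))\cong K_0(B^p_u(\Lambda))$ (as abelian groups) for all $p\in[1,\infty)$. \item[(3)] $K_0(B^p_u(\Gamma))\cong K_0(B^p_u(\Lambda))$ (as abelian groups) for some $p\in[1,\infty)$. \end{enumerate}
   Context: A discrete group is locally finite if every finitely generated subgroup is finite. A countable group with a proper (balls are finite) left-invariant metric is a metric space with bounded geometry, i.e. for any $R>0$ the closed $R$-balls have uniformly bounded cardinality. For a bounded geometry metric space $(X,d)$ and $T\in B(\ell^p(X))$ write $T_{xy}=(T\delta_y)(x)$ and $\mathrm{prop}(T)=\sup\{d(x,y):x,y\in X,\ T_{xy}\neq 0\}\in[0,\infty]$. The $\ell^p$ uniform Roe algebra $B^p_u(X)$ is the operator norm closure in $B(\ell^p(X))$ of the algebra of all bounded operators on $\ell^p(X)$ with finite propagation. A (not necessarily continuous) map $f:X\to Y$ of metric spaces is uniformly expansive if for all $R>0$ there exists $S>0$ such that $d(x_1,x_2)\le R$ implies $d(f(x_1),f(x_2))\le S$. Two maps $f,g:X\to Y$ are close if there is $C>0$ with $d(f(x),g(x))\le C$ for all $x\in X$. $X$ and $Y$ are coarsely equivalent if there exist uniformly expansive maps $f:X\to Y$ and $g:Y\to X$ such that $f\circ g$ and $g\circ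 f$ are close to the respective identity maps. *)

(* Defs.v *)
From HB Require Import structures.
From mathcomp Require Import all_boot all_order all_algebra generic_quotient.
From mathcomp Require Import complex.
From mathcomp Require Import all_classical all_reals all_analysis.
From mathcomp Require Import ring lra.

Set Implicit Arguments.
Unset Strict Implicit.
Unset Printing Implicit Defensive.

Import Order.TTheory GRing.Theory Num.Theory.
Import numFieldNormedType.Exports.
Import Normc.
Local Open Scope classical_set_scope.
Local Open Scope ring_scope.

Local Open Scope quotient_scope.

(* The class of (a, b) stands for the formal difference a - b.                *)
Section Grothendieck.
Variable M : nmodType.

Definition groth_rel (x y : M * M) : bool :=
  `[< exists z, x.1 + y.2 + z = y.1 + x.2 + z >].

Lemma groth_rel_equiv : equiv_class_of groth_rel.
Proof.
split=> [x|x y|y x z].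
- by apply/asboolP; exists 0.
- by apply/asboolP/asboolP => -[z zP]; exists z.
- move=> /asboolP[s sP] /asboolP[t tP]; apply/asboolP; exists (y.1 + y.2 + s + t).
  transitivity ((x.1 + y.2 + s) + (y.1 + z.2 + t)); last rewrite sP tP.
    by rewrite (AC (2*4) ((1*4*5)*(3*2*6))).
  by rewrite (AC (3*3) ((4*2)*(1*5*3*6))).
Qed.

Canonical groth_equiv := EquivRelPack groth_rel_equiv.
Definition groth := {eq_quot groth_equiv}.
HB.instance Definition _ := Choice.on groth.
HB.instance Definition _ := EqQuotient.on groth.

Lemma grothP (x y : M * M) :
  (\pi_groth x = \pi_groth y) <-> exists z, x.1 + y.2 + z = y.1 + x.2 + z.
Proof. by split => [/eqmodP/asboolP|?]//; apply/eqmodP/asboolP. Qed.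

Definition groth_add (a b : groth) : groth :=
  \pi_groth ((repr a).1 + (repr b).1, (repr a).2 + (repr b).2).
Definition groth_opp (a : groth) : groth := \pi_groth ((repr a).2, (repr a).1).
Definition groth_zero : groth := \pi_groth (0, 0).

Lemma groth_addE (x y : M * M) :
  groth_add (\pi_groth x) (\pi_groth y) = \pi_groth (x.1 + y.1, x.2 + y.2).
Proof.
rewrite /groth_add; apply/grothP.
have /grothP[s sP] := reprK (\pi_groth x).
have /grothP[t tP] := reprK (\pi_groth y).
exists (s + t); rewrite /=.
transitivity (((repr (\pi_groth x)).1 + x.2 + s) +
  ((repr (\pi_groth y)).1 + y.2 + t)); last rewrite sP tP.
  by rewrite (AC (2*2*2) ((1*3*5)*(2*4*6))).
by rewrite (AC (3*3) (1*4*(2*5)*(3*6))).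
Qed.

Lemma groth_oppE (x : M * M) : groth_opp (\pi_groth x) = \pi_groth (x.2, x.1).
Proof.
rewrite /groth_opp; apply/grothP.
have /grothP[s sP] := reprK (\pi_groth x).
by exists s; rewrite /= [_ + x.1]addrC [x.2 + _]addrC sP.
Qed.

Lemma groth_addA : associative groth_add.
Proof.
elim/quotW=> x; elim/quotW=> y; elim/quotW=> z.
by rewrite (groth_addE y z) (groth_addE x y) !groth_addE/= !addrA.
Qed.

Lemma groth_addC : commutative groth_add.
Proof.
elim/quotW=> x; elim/quotW=> y; rewrite !groth_addE.
by rewrite [x.1 + _]addrC [x.2 + _]addrC.
Qed.

Lemma groth_add0 : left_id groth_zero groth_add.
Proof.
by elim/quotW=> x; rewrite groth_addE/= !add0r -surjective_pairing.
Qed.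

Lemma groth_addN : left_inverse groth_zero groth_opp groth_add.
Proof.
elim/quotW=> x; rewrite groth_oppE groth_addE/=.
by apply/grothP; exists 0; rewrite /= !addr0 add0r addrC.
Qed.

HB.instance Definition _ :=
  GRing.isZmodule.Build groth groth_addA groth_addC groth_add0 groth_addN.
End Grothendieck.

(* The operator K-group K_0 of a unital Banach algebra depends only on its    *)
(* underlying ring: it is the Grothendieck group of the monoid of             *)
(* (Murray-von Neumann) equivalence classes of idempotents in matrices of     *)
(* arbitrary finite size, e ~ f iff e = u v and f = v u with u, v             *)
(* rectangular, under block-diagonal sum.                                     *)
Section K0.
Variable A : pzRingType.

Definition idem :=
  {e : {n : nat & 'M[A]_n} | tagged e *m tagged e == tagged e}.

HB.instance Definition _ := Choice.on idem.

Definition idem_mx (e : idem) : 'M[A]_(tag (val e)) := tagged (val e).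

Definition mkidem n (e : 'M[A]_n) (ee : e *m e = e) : idem :=
  exist _ (Tagged (fun n => 'M[A]_n) e) (introT eqP ee).

Lemma idem_mxK (e : idem) : idem_mx e *m idem_mx e = idem_mx e.
Proof. exact/eqP/(valP e). Qed.

Definition mvn_rel n m (e : 'M[A]_n) (f : 'M[A]_m) : Prop :=
  exists (u : 'M[A]_(n, m)) (v : 'M[A]_(m, n)), u *m v = e /\ v *m u = f.

Definition idem_rel (e f : idem) : bool :=
  `[< mvn_rel (idem_mx e) (idem_mx f) >].

Lemma idem_rel_equiv : equiv_class_of idem_rel.
Proof.
split=> [e|e f|f e g].
- by apply/asboolP; exists (idem_mx e), (idem_mx e); split; exact: idem_mxK.
- by apply/asboolP/asboolP => -[u [v [uv vu]]]; exists v, u.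
- move=> /asboolP[u [v [uv vu]]] /asboolP[u' [v' [uv' vu']]]; apply/asboolP.
  exists (u *m u'), (v' *m v); split.
    by rewrite mulmxA -(mulmxA u) uv' -vu !mulmxA uv -mulmxA uv idem_mxK.
  by rewrite mulmxA -(mulmxA v') vu -uv' !mulmxA vu' -mulmxA vu' idem_mxK.
Qed.

Canonical idem_equiv := EquivRelPack idem_rel_equiv.
Definition idem_classes := {eq_quot idem_equiv}.
HB.instance Definition _ := Choice.on idem_classes.
HB.instance Definition _ := EqQuotient.on idem_classes.

Lemma idem_classesP (e f : idem) :
  (\pi_idem_classes e = \pi_idem_classes f) <-> mvn_rel (idem_mx e) (idem_mx f).
Proof. by split => [/eqmodP/asboolP|?]//; apply/eqmodP/asboolP. Qed.

Lemma idem_sum_subproof (e f : idem) :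
  let s := block_mx (idem_mx e) 0 0 (idem_mx f) in s *m s = s.
Proof.
by rewrite /= mulmx_block !mulmx0 !mul0mx !addr0 !add0r !idem_mxK.
Qed.

Definition idem_sum (e f : idem) : idem := mkidem (idem_sum_subproof e f).

Lemma idem0_subproof : (0 : 'M[A]_0) *m (0 : 'M[A]_0) = 0.
Proof. by rewrite mulmx0. Qed.

Definition idem0 : idem := mkidem idem0_subproof.

Definition idem_classes_add (a b : idem_classes) : idem_classes :=
  \pi_idem_classes (idem_sum (repr a) (repr b)).
Definition idem_classes0 : idem_classes := \pi_idem_classes idem0.

Lemma mvn_block n m n' m' (e : 'M[A]_n) (f : 'M[A]_m)
    (e' : 'M[A]_n') (f' : 'M[A]_m') :
  mvn_rel e f -> mvn_rel e' f' ->
  mvn_rel (block_mx e 0 0 e') (block_mx f 0 0 f').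
Proof.
move=> [u [v [uv vu]]] [u' [v' [uv' vu']]].
exists (block_mx u 0 0 u'), (block_mx v 0 0 v').
by rewrite !mulmx_block !mulmx0 !mul0mx !addr0 !add0r uv vu uv' vu'.
Qed.

Lemma idem_classes_addE (e f : idem) :
  idem_classes_add (\pi_idem_classes e) (\pi_idem_classes f) =
  \pi_idem_classes (idem_sum e f).
Proof.
by apply/idem_classesP/mvn_block; apply/idem_classesP; rewrite reprK.
Qed.

Lemma mvn_cast n m (nm : n = m) (e : 'M[A]_n) : e *m e = e ->
  mvn_rel e (castmx (nm, nm) e).
Proof. by case: m / nm => ee; exists e, e. Qed.

Lemma idem_classes_addA : associative idem_classes_add.
Proof.
elim/quotW=> e; elim/quotW=> f; elim/quotW=> g.
rewrite (idem_classes_addE f g) (idem_classes_addE e f) !idem_classes_addE.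
apply/esym/idem_classesP.
have := mvn_cast (esym (addnA _ _ _)) (idem_mxK (idem_sum (idem_sum e f) g)).
by rewrite {2}/idem_mx/= -[in X in castmx _ (block_mx _ X _ _)](col_mx0 A)
  -[in X in castmx _ (block_mx _ _ X _)](row_mx0 A) -block_mxA col_mx0 row_mx0.
Qed.

Lemma idem_classes_addC : commutative idem_classes_add.
Proof.
elim/quotW=> e; elim/quotW=> f; rewrite !idem_classes_addE.
apply/idem_classesP.
exists (block_mx 0 (idem_mx e) (idem_mx f) 0).
exists (block_mx 0 (idem_mx f) (idem_mx e) 0).
by rewrite !mulmx_block !mulmx0 !mul0mx !addr0 !add0r !idem_mxK.
Qed.

Lemma idem_classes_add0 : left_id idem_classes0 idem_classes_add.
Proof.
elim/quotW=> e; rewrite idem_classes_addE; apply/idem_classesP.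
exists (col_mx 0 (idem_mx e)), (row_mx 0 (idem_mx e)).
by rewrite mul_col_row mul_row_col !mulmx0 !mul0mx add0r idem_mxK.
Qed.

HB.instance Definition _ := GRing.isNmodule.Build idem_classes
  idem_classes_addA idem_classes_addC idem_classes_add0.

Definition K0 := groth idem_classes.
HB.instance Definition _ := GRing.Zmodule.on K0.
End K0.

(* `R[i]^o` is the field of complex numbers as a module over itself and       *)
(* `normc` is the real-valued modulus. `lp_sum`, `lp_norm` and `opnorm` are   *)
(* locked only to keep conversion from unfolding them.                        *)
HB.lock Definition lp_sum (R : realType) (X : choiceType) (p : R)
    (f : X -> R[i]^o) : \bar R :=
  \esum_(x in [set: X]) (normc (f x) `^ p)%:E.

Section LpSum.
Variables (R : realType) (X : choiceType) (p : R).
Implicit Types f g : X -> R[i]^o.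
Local Notation lp_sum := (lp_sum p).

Lemma normc_ge0 (c : R[i]) : 0 <= normc c.
Proof. by case: c => a b; exact: sqrtr_ge0. Qed.

Lemma lp_sum_ge0 f : (0 <= lp_sum f)%E.
Proof.
by rewrite lp_sum.unlock; apply: esum_ge0 => x _; rewrite lee_fin powR_ge0. Qed.

Lemma esumZ_le (k : R) (a : X -> \bar R) : 0 <= k -> (forall x, (0 <= a x)%E) ->
  (\esum_(x in [set: X]) (k%:E * a x) <= k%:E * \esum_(x in [set: X]) a x)%E.
Proof.
move=> k0 a0; apply: ge_ereal_sup => _ [F [finF _] <-].
rewrite -ge0_mule_fsumr//.
apply: lee_wpmul2l; first by rewrite lee_fin.
by apply: esum_ge; exists F.
Qed.

Lemma lp_sum_ge f x : ((normc (f x) `^ p)%:E <= lp_sum f)%E.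
Proof.
rewrite lp_sum.unlock; apply: esum_ge; exists [set x]; first by split => //; exact: finite_set1.
by rewrite fsbig_set1.
Qed.

Hypothesis p1 : 1 <= p.

Let p0 : 0 < p. Proof. exact: lt_le_trans p1. Qed.

Lemma powR_convex (a b s t : R) : 0 <= a -> 0 <= b -> 0 <= s -> 0 <= t ->
  s + t = 1 -> (s * a + t * b) `^ p <= s * a `^ p + t * b `^ p.
Proof.
move=> a0 b0 s0 t0 st; have -> : t = 1 - s by rewrite -st addrC addKr.
have s1 : s <= 1 by rewrite -st lerDl.
by apply: (convex_powR p1 (Itv01 s0 s1)) => //=; rewrite ?inE/= ?in_itv/= ?andbT.
Qed.

Lemma lp_sumD_le f g a b : 0 < a -> 0 < b ->
  (lp_sum f <= (a `^ p)%:E)%E -> (lp_sum g <= (b `^ p)%:E)%E ->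
  (lp_sum (f + g)%R <= ((a + b) `^ p)%:E)%E.
Proof.
move=> a0 b0 fa gb; have s0 : 0 < a + b by rewrite addr_gt0.
pose k1 := (a + b) `^ p * (a / (a + b)) * a^-1 `^ p.
pose k2 := (a + b) `^ p * (b / (a + b)) * b^-1 `^ p.
have k10 : 0 <= k1 by rewrite !mulr_ge0 ?powR_ge0 ?invr_ge0// ltW.
have k20 : 0 <= k2 by rewrite !mulr_ge0 ?powR_ge0 ?invr_ge0// ltW.
have kE c : 0 < c -> c^-1 `^ p * c `^ p = 1.
  by move=> c0; rewrite -powRM ?invr_ge0 ?ltW// mulVf ?gt_eqF// powR1.
apply: (@le_trans _ _ (k1%:E * lp_sum f + k2%:E * lp_sum g)%E); last first.
  apply: (@le_trans _ _ (k1%:E * (a `^ p)%:E + k2%:E * (b `^ p)%:E)%E).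
    by apply: leeD; apply: lee_wpmul2l; rewrite ?lee_fin.
  rewrite -!EFinM -EFinD lee_fin -!mulrA !kE// !mulr1 -mulrDr -mulrDl.
  by rewrite divff ?gt_eqF// mulr1.
rewrite lp_sum.unlock.
apply: le_trans (leeD (esumZ_le k10 _) (esumZ_le k20 _)); last 2 first.
  by move=> x; rewrite lee_fin powR_ge0.
  by move=> x; rewrite lee_fin powR_ge0.
rewrite -esumD => [|x _|x _]; last 2 first.
  by rewrite -EFinM lee_fin mulr_ge0 ?powR_ge0.
  by rewrite -EFinM lee_fin mulr_ge0 ?powR_ge0.
apply: le_esum => x _; rewrite -!EFinM -EFinD lee_fin.
set A := normc (f x); set B := normc (g x).
have A0 : 0 <= A by exact: normc_ge0.
have B0 : 0 <= B by exact: normc_ge0.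
apply: (@le_trans _ _ ((A + B) `^ p)).
  rewrite ge0_ler_powR ?nnegrE ?normc_ge0 ?addr_ge0 ?(ltW p0)//.
  exact: le_normcD.
have -> : A + B = (a + b) * (a / (a + b) * (a^-1 * A) + b / (a + b) * (b^-1 * B)).
  by field; rewrite !gt_eqF.
rewrite powRM ?(ltW s0)//; last first.
  by rewrite addr_ge0 ?mulr_ge0 ?invr_ge0 ?(ltW a0) ?(ltW b0) ?(ltW s0).
rewrite /k1 /k2 -!mulrA -mulrDr ler_wpM2l ?powR_ge0//.
rewrite !mulrA -!(mulrA _ (_ `^ p)) -!powRM ?invr_ge0 ?(ltW a0) ?(ltW b0)// -!mulrA !(mulrA a) !(mulrA b).
apply: powR_convex; rewrite ?mulr_ge0 ?invr_ge0 ?(ltW a0) ?(ltW b0) ?(ltW s0)//.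
by rewrite -mulrDl divff ?gt_eqF.
Qed.

Lemma lp_sumZ_le (c : R[i]) f :
  (lp_sum (c *: f)%R <= (normc c `^ p)%:E * lp_sum f)%E.
Proof.
rewrite lp_sum.unlock; apply: le_trans (esumZ_le (powR_ge0 _ _) _); last first.
  by move=> x; rewrite lee_fin powR_ge0.
apply: le_esum => x _; rewrite -EFinM lee_fin -powRM ?normc_ge0//.
by rewrite -normcM.
Qed.

Lemma lp_sum0 : lp_sum (0 : X -> R[i]^o) = 0%E.
Proof.
by rewrite lp_sum.unlock; apply: esum1 => x _; rewrite normc0 powR0 ?gt_eqF.
Qed.

End LpSum.

Section Lp.
Variables (R : realType) (X : choiceType).

(* The argument `1 <= p` is carried so that the normed structure on `lp`      *)
(* below can be canonical.                                                    *)
Definition lp_pred (p : R) of 1 <= p : {pred X -> R[i]^o} :=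
  fun f => `[< (lp_sum p f < +oo)%E >].

Variables (p : R) (p1 : 1 <= p).
Let p0 : 0 < p. Proof. exact: lt_le_trans p1. Qed.

Lemma lp_bound (f : X -> R[i]^o) : (lp_sum p f < +oo)%E ->
  exists2 a, 0 < a & (lp_sum p f <= (a `^ p)%:E)%E.
Proof.
move=> foo; have fin : lp_sum p f \is a fin_num.
  by rewrite ge0_fin_numE ?lp_sum_ge0.
exists ((fine (lp_sum p f) + 1) `^ p^-1).
  by apply: powR_gt0; rewrite ltr_wpDl// fine_ge0 ?lp_sum_ge0.
rewrite -powRrM mulVf ?gt_eqF// powRr1 ?addr_ge0 ?fine_ge0 ?lp_sum_ge0//.
by rewrite EFinD fineK// leeDl.
Qed.

Lemma lp_submod_closed : submod_closed (lp_pred p1).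
Proof.
split=> [|c f g]; first by apply/asboolP; rewrite lp_sum0.
move=> /asboolP foo /asboolP goo; apply/asboolP.
have cfoo : (lp_sum p (c *: f)%R < +oo)%E.
  apply: le_lt_trans (lp_sumZ_le _ _ _) _.
  by rewrite lte_mul_pinfty// ?lee_fin ?powR_ge0 // ltNge leye_eq.
have [a a0 fa] := lp_bound cfoo; have [b b0 gb] := lp_bound goo.
exact: le_lt_trans (lp_sumD_le p1 a0 b0 fa gb) (ltry _).
Qed.

HB.instance Definition _ :=
  GRing.isSubmodClosed.Build R[i] (X -> R[i]^o) (lp_pred p1) lp_submod_closed.

Record lp := Lp { lp_fun :> X -> R[i]^o; lp_funP : lp_fun \in lp_pred p1 }.

HB.instance Definition _ := [isSub for lp_fun].
HB.instance Definition _ := [Choice of lp by <:].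
HB.instance Definition _ := [SubChoice_isSubLmodule of lp by <:].

End Lp.

HB.lock Definition lp_norm (R : realType) (X : choiceType) (p : R)
    (p1 : 1 <= p) (f : lp X p1) : R :=
  fine (lp_sum p f) `^ p^-1.

Section LpNorm.
Variables (R : realType) (X : choiceType) (p : R) (p1 : 1 <= p).
Let p0 : 0 < p. Proof. exact: lt_le_trans p1. Qed.
Local Notation lp := (lp X p1).
Implicit Types f g : lp.

Lemma lp_sum_fin f : lp_sum p f \is a fin_num.
Proof. by rewrite ge0_fin_numE ?lp_sum_ge0//; exact/asboolP/lp_funP. Qed.

Lemma lp_norm_ge0 f : 0 <= lp_norm f.
Proof. by rewrite lp_norm.unlock powR_ge0. Qed.

Lemma lp_norm_powR f : (lp_norm f `^ p)%:E = lp_sum p f.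
Proof.
rewrite lp_norm.unlock -powRrM mulVf ?gt_eqF// powRr1 ?fine_ge0 ?lp_sum_ge0//.
by rewrite fineK// lp_sum_fin.
Qed.

Lemma lp_norm_le f a : 0 <= a -> (lp_norm f <= a) = (lp_sum p f <= (a `^ p)%:E)%E.
Proof.
move=> a0; rewrite -lp_norm_powR lee_fin; apply/idP/idP => [fa|].
  by rewrite ge0_ler_powR ?nnegrE ?lp_norm_ge0 ?(ltW p0).
apply: contraTT; rewrite -!ltNge => af.
by rewrite gt0_ltr_powR ?nnegrE ?lp_norm_ge0.
Qed.

Lemma lp_normD f g : lp_norm (f + g) <= lp_norm f + lp_norm g.
Proof.
apply/ler_addgt0Pr => e e0.
have e20 : 0 < e / 2 by rewrite divr_gt0.
have := lp_norm_ge0 f; have := lp_norm_ge0 g => g0 f0.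
have -> : lp_norm f + lp_norm g + e = (lp_norm f + e / 2) + (lp_norm g + e / 2).
  by rewrite addrACA -splitr.
have fe0 : 0 < lp_norm f + e / 2 by rewrite ltr_wpDl.
have ge0 : 0 < lp_norm g + e / 2 by rewrite ltr_wpDl.
rewrite (lp_norm_le _ (ltW (addr_gt0 fe0 ge0))); apply: lp_sumD_le => //.
  by rewrite -(lp_norm_le _ (ltW fe0)) lerDl ltW.
by rewrite -(lp_norm_le _ (ltW ge0)) lerDl ltW.
Qed.

Lemma lp_funZ (c : R[i]) f : lp_fun (c *: f) = c *: lp_fun f.
Proof. by []. Qed.

Lemma lp_normZ_le (c : R[i]) f : lp_norm (c *: f) <= normc c * lp_norm f.
Proof.
have cf0 : 0 <= normc c * lp_norm f.
  exact: mulr_ge0 (normc_ge0 c) (lp_norm_ge0 f).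
rewrite (lp_norm_le _ cf0).
rewrite (powRM _ (normc_ge0 c) (lp_norm_ge0 f)) EFinM lp_norm_powR lp_funZ.
exact: lp_sumZ_le.
Qed.

Lemma lp_norm0 : lp_norm (0 : lp) = 0.
Proof.
apply/eqP; rewrite eq_le lp_norm_ge0 andbT (lp_norm_le _ (lexx 0)).
by rewrite [X in (X <= _)%E]lp_sum0// lee_fin powR_ge0.
Qed.

Lemma lp_normZ (c : R[i]) f : lp_norm (c *: f) = normc c * lp_norm f.
Proof.
have [->|c0] := eqVneq c 0; first by rewrite scale0r lp_norm0 normc0 mul0r.
apply/eqP; rewrite eq_le lp_normZ_le/=.
have nc0 : 0 < normc c.
  rewrite lt_neqAle normc_ge0 andbT eq_sym; apply: contra c0 => /eqP.
  by move=> /eq0_normc ->.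
rewrite -ler_pdivlMl// -normcV.
by have := lp_normZ_le c^-1 (c *: f); rewrite scalerA mulVf// scale1r.
Qed.

Lemma lp_norm_ge f x : normc (f x) <= lp_norm f.
Proof.
rewrite leNgt; apply/negP => h.
have := lp_sum_ge p f x; rewrite -lp_norm_powR lee_fin leNgt => /negP; apply.
by rewrite gt0_ltr_powR ?nnegrE ?lp_norm_ge0 ?normc_ge0.
Qed.

Lemma lp_norm0_eq0 f : lp_norm f = 0 -> f = 0.
Proof.
move=> f0; apply/val_inj/funext => x; apply/eq0_normc/eqP.
by rewrite eq_le normc_ge0 andbT -f0; exact: lp_norm_ge.
Qed.

Lemma normc_nat n : normc (n%:R : R[i]) = n%:R.
Proof. by rewrite normcMn normc1. Qed.

Lemma lp_normMn f n : lp_norm (f *+ n) = lp_norm f *+ n.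
Proof. by rewrite -scaler_nat lp_normZ normc_nat mulr_natl. Qed.

Lemma lp_normN f : lp_norm (- f) = lp_norm f.
Proof. by rewrite -scaleN1r lp_normZ normcN normc1 mul1r. Qed.

HB.instance Definition _ := Num.Zmodule_isNormed.Build R lp
  lp_normD lp_norm0_eq0 lp_normMn lp_normN.

Lemma lp_normrE f : `|f| = lp_norm f. Proof. by []. Qed.

Lemma normr_lpZ (c : R[i]) f : `|c *: f| = normc c * `|f|.
Proof. exact: lp_normZ. Qed.

Lemma delta_subproof (y : X) :
  (fun x => (x == y)%:R : R[i]^o) \in lp_pred p1.
Proof.
apply/asboolP; rewrite lp_sum.unlock.
have -> : \esum_(x in [set: X]) (normc ((x == y)%:R : R[i]) `^ p)%:E =
    \esum_(x in [set y]) 1%E :> \bar R; last by rewrite esum_set1 ?ltry.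
rewrite (esum_mkcond [set y]); apply: eq_esum => x _ /=.
have [->|xy] := eqVneq x y; first by rewrite in_set1 eqxx normc1 powR1.
by rewrite in_set1 (negbTE xy) normc0 powR0 ?gt_eqF.
Qed.

Definition delta (y : X) : lp := Lp (delta_subproof y).


Lemma lp_fun_sum f (s : seq X) x : uniq s ->
  (\sum_(y <- s) f y *: delta y : lp) x = if x \in s then f x else 0.
Proof.
move=> us; have -> : (\sum_(y <- s) f y *: delta y : lp) x =
    \sum_(y <- s) f y * (x == y)%:R.
  elim: s {us} => [|y s ih]; first by rewrite !big_nil.
  by rewrite !big_cons -ih.
case: ifPn => xs.
  rewrite (bigD1_seq x)//= eqxx mulr1 big1 ?addr0// => y /negbTE yx.
  by rewrite eq_sym yx mulr0.
rewrite big_seq big1// => y ys; rewrite (_ : (x == y) = false) ?mulr0//.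
by apply: contraNF xs => /eqP ->.
Qed.

Lemma lp_approx f (e : R) : 0 < e ->
  exists2 s : seq X, uniq s & `|f - \sum_(y <- s) f y *: delta y| <= e.
Proof.
move=> e0; have fin := lp_sum_fin f.
have ep : 0 < e `^ p by exact: powR_gt0.
have a0 x : (0 <= (normc (f x) `^ p)%:E)%E by rewrite lee_fin powR_ge0.
have [F [finF _] hF] : exists2 F, fsets [set: X] F &
   (lp_sum p f - (e `^ p)%:E < \sum_(x \in F) (normc (f x) `^ p)%:E)%E.
  have : (lp_sum p f - (e `^ p)%:E < lp_sum p f)%E.
    by rewrite lteBlDr// lteDl// lte_fin.
  rewrite {2}lp_sum.unlock => /ereal_sup_gt[_ [F FX <-] h].
  by exists F.
have /finite_seqP[s sF] := finF.
exists (undup s); first exact: undup_uniq.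
rewrite lp_normrE (lp_norm_le _ (ltW e0)).
set g := f - _.
have gE x : g x = if x \in F then 0 else f x.
  rewrite (_ : g x = f x - (\sum_(y <- undup s) f y *: delta y : lp) x)//.
  rewrite lp_fun_sum ?undup_uniq// mem_undup sF mem_setE.
  by case: ifP; rewrite ?subrr ?subr0.
have -> : lp_sum p g = \esum_(x in ~` F) (normc (f x) `^ p)%:E.
  rewrite lp_sum.unlock [RHS]esum_mkcond; apply: eq_esum => x _.
  rewrite gE in_setC; case: (x \in F) => //.
  by rewrite [normc _]normc0 powR0 ?gt_eqF.
have : lp_sum p f = (\esum_(x in F) (normc (f x) `^ p)%:E +
   \esum_(x in ~` F) (normc (f x) `^ p)%:E)%E.
  by rewrite lp_sum.unlock (esumID F)// !setTI.
rewrite esum_fset// => sumE.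
move: hF fin; rewrite sumE fin_numD => h /andP[Sfin Tfin].
by move: h; rewrite lteBlDr// lteD2lE// => /ltW.
Qed.

End LpNorm.

Section BoundedOp.
Variables (R : realType) (X : choiceType) (p : R) (p1 : 1 <= p).
Local Notation lp := (lp X p1).

Definition bounded_linear : {pred lp -> lp} := fun T =>
  `[< linear T /\ exists C : R, forall f, `|T f| <= C * `|f| >].

Lemma bounded_linear_submod : submod_closed bounded_linear.
Proof.
split=> [|c S T].
  apply/asboolP; split=> [a f g|]; first by rewrite scaler0 addr0.
  by exists 0 => f; rewrite mul0r normr0.
move=> /asboolP[Sl [C SC]] /asboolP[Tl [D TD]]; apply/asboolP; split.
  move=> a f g; rewrite -[LHS]/(c *: S (a *: f + g) + T (a *: f + g)).
  rewrite -[RHS]/(a *: (c *: S f + T f) + (c *: S g + T g)).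
  rewrite Sl Tl !scalerDr !scalerA [a * c]mulrC -!addrA; congr (_ + _).
  by rewrite addrCA.
exists (normc c * C + D) => f.
rewrite -[X in `|X|]/(c *: S f + T f).
apply: le_trans (ler_normD _ _) _; rewrite mulrDl lerD//.
by rewrite normr_lpZ -mulrA ler_wpM2l// normc_ge0.
Qed.

HB.instance Definition _ := GRing.isSubmodClosed.Build R[i] (lp -> lp)
  bounded_linear bounded_linear_submod.

Record bop := Bop { bop_fun :> lp -> lp; bop_funP : bop_fun \in bounded_linear }.

HB.instance Definition _ := [isSub for bop_fun].
HB.instance Definition _ := [Choice of bop by <:].
HB.instance Definition _ := [SubChoice_isSubLmodule of bop by <:].

End BoundedOp.

HB.lock Definition opnorm (R : realType) (X : choiceType) (p : R)
    (p1 : 1 <= p) (T : bop X p1) : R :=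
  sup [set `|T f| | f in [set f | `|f| <= 1]].

Section OpNorm.
Variables (R : realType) (X : choiceType) (p : R) (p1 : 1 <= p).
Local Notation lp := (lp X p1).
Local Notation bop := (bop X p1).
Implicit Types (S T U : bop) (f g : lp).

Lemma bop_linear T : linear T.
Proof. by have /asboolP[] := bop_funP T. Qed.

Lemma bop_bounded T : exists2 C : R, 0 <= C & forall f, `|T f| <= C * `|f|.
Proof.
have /asboolP[_ [C TC]] := bop_funP T; exists `|C|; first exact: normr_ge0.
by move=> f; apply: le_trans (TC f) _; rewrite ler_wpM2r// ler_norm.
Qed.

HB.instance Definition _ T :=
  GRing.isLinear.Build R[i] lp lp *:%R T (bop_linear T).

Lemma opnorm_has_sup T : has_sup [set `|T f| | f in [set f | `|f| <= 1]].
Proof.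
split; first by exists `|T 0|; exists 0 => //=; rewrite normr0.
have [C C0 TC] := bop_bounded T; exists C => _ [f /= f1 <-].
by apply: le_trans (TC f) _; rewrite -[leRHS]mulr1 ler_wpM2l.
Qed.

Lemma opnorm_ge0 T : 0 <= opnorm T.
Proof.
rewrite opnorm.unlock; apply: le_trans (normr_ge0 (T 0)) _.
by apply: sup_upper_bound; [exact: opnorm_has_sup|exists 0; rewrite //= normr0].
Qed.

Lemma normc_real (r : R) : 0 <= r -> normc (r%:C)%C = r.
Proof. by move=> r0; rewrite /normc/= expr0n addr0 sqrtr_sqr ger0_norm. Qed.

Lemma opnormP T f : `|T f| <= opnorm T * `|f|.
Proof.
have [->|f0] := eqVneq f 0; first by rewrite linear0 !normr0 mulr0.
have nf0 : 0 < `|f| by rewrite normr_gt0.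
rewrite -ler_pdivrMr// mulrC.
have := normr_lpZ ((`|f|^-1)%:C)%C (T f).
rewrite normc_real ?invr_ge0// => <-; rewrite -linearZ opnorm.unlock.
apply: sup_upper_bound; first exact: opnorm_has_sup.
exists ((`|f|^-1)%:C%C *: f) => //=.
by rewrite normr_lpZ normc_real ?invr_ge0// mulVf ?gt_eqF.
Qed.

Lemma opnorm_le T C : 0 <= C -> (forall f, `|T f| <= C * `|f|) -> opnorm T <= C.
Proof.
move=> C0 TC; rewrite opnorm.unlock; apply: ge_sup.
  by exists `|T 0|; exists 0 => //=; rewrite normr0.
move=> _ [f /= f1 <-].
by apply: le_trans (TC f) _; rewrite -[leRHS]mulr1 ler_wpM2l.
Qed.

Lemma bop_ext S T : (forall f, S f = T f) -> S = T.
Proof. by move=> ST; apply/val_inj/funext. Qed.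

Lemma opnormD S T : opnorm (S + T) <= opnorm S + opnorm T.
Proof.
apply: opnorm_le; first exact: addr_ge0 (opnorm_ge0 S) (opnorm_ge0 T).
move=> f; rewrite (_ : (S + T) f = S f + T f)//.
by apply: le_trans (ler_normD _ _) _; rewrite mulrDl lerD ?opnormP.
Qed.

Lemma opnorm0_eq0 T : opnorm T = 0 -> T = 0.
Proof.
move=> T0; apply: bop_ext => f; apply/eqP; rewrite -normr_le0.
by have := opnormP T f; rewrite T0 mul0r.
Qed.

Lemma opnormZ_le (c : R[i]) T : opnorm (c *: T) <= normc c * opnorm T.
Proof.
apply: opnorm_le; first exact: mulr_ge0 (normc_ge0 c) (opnorm_ge0 T).
move=> f; rewrite (_ : (c *: T) f = c *: T f)// normr_lpZ -mulrA.
by rewrite ler_wpM2l ?normc_ge0 ?opnormP.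
Qed.

Lemma opnorm0 : opnorm (0 : bop) = 0.
Proof.
apply/eqP; rewrite eq_le opnorm_ge0 andbT; apply: opnorm_le => // f.
by rewrite (_ : (0 : bop) f = 0)// normr0 mul0r.
Qed.

Lemma opnormZ (c : R[i]) T : opnorm (c *: T) = normc c * opnorm T.
Proof.
have [->|c0] := eqVneq c 0; first by rewrite scale0r opnorm0 normc0 mul0r.
apply/eqP; rewrite eq_le opnormZ_le/=.
have nc0 : 0 < normc c.
  rewrite lt_neqAle normc_ge0 andbT eq_sym; apply: contra c0 => /eqP.
  by move=> /eq0_normc ->.
rewrite -ler_pdivlMl// -normcV.
by have := opnormZ_le c^-1 (c *: T); rewrite scalerA mulVf// scale1r.
Qed.

Lemma opnormMn T n : opnorm (T *+ n) = opnorm T *+ n.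
Proof. by rewrite -scaler_nat opnormZ normc_nat mulr_natl. Qed.

Lemma opnormN T : opnorm (- T) = opnorm T.
Proof. by rewrite -scaleN1r opnormZ normcN normc1 mul1r. Qed.

HB.instance Definition _ := Num.Zmodule_isNormed.Build R bop
  opnormD opnorm0_eq0 opnormMn opnormN.
HB.instance Definition _ := PseudoMetric.copy bop (pseudoMetric_normed bop).
HB.instance Definition _ := isPointed.Build bop 0.
HB.instance Definition _ := NormedZmod_PseudoMetric_eq.Build R bop erefl.

Lemma bop1_subproof : id \in @bounded_linear R X p p1.
Proof. by apply/asboolP; split=> //; exists 1 => f; rewrite mul1r. Qed.

Definition bop1 : bop := Bop bop1_subproof.

Lemma bop_comp_subproof S T : S \o T \in @bounded_linear R X p p1.
Proof.
apply/asboolP; split=> [c f g|]; first by rewrite /= !linearP.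
exists (opnorm S * opnorm T) => f /=; apply: le_trans (opnormP S _) _.
by rewrite -mulrA ler_wpM2l ?opnorm_ge0 ?opnormP.
Qed.

Definition bop_comp S T : bop := Bop (bop_comp_subproof S T).

Fact bop_compA : associative bop_comp.
Proof. by move=> S T U; exact: bop_ext. Qed.

Fact bop_comp1l : left_id bop1 bop_comp.
Proof. by move=> T; exact: bop_ext. Qed.

Fact bop_comp1r : right_id bop1 bop_comp.
Proof. by move=> T; exact: bop_ext. Qed.

Fact bop_compDl : left_distributive bop_comp +%R.
Proof. by move=> S T U; exact: bop_ext. Qed.

Fact bop_compDr : right_distributive bop_comp +%R.
Proof. by move=> S T U; apply: bop_ext => f; exact: linearD. Qed.

HB.instance Definition _ := GRing.Zmodule_isPzRing.Build bop
  bop_compA bop_comp1l bop_comp1r bop_compDl bop_compDr.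

Lemma bopME S T f : (S * T) f = S (T f). Proof. by []. Qed.

Lemma ler_bopM S T : `|S * T| <= `|S| * `|T|.
Proof.
apply: opnorm_le; first exact: mulr_ge0 (opnorm_ge0 S) (opnorm_ge0 T).
move=> f; rewrite bopME; apply: le_trans (opnormP S _) _.
by rewrite -mulrA ler_wpM2l ?opnorm_ge0 ?opnormP.
Qed.

Lemma closure_bopP (A : set bop) T :
  closure A T <-> forall e, 0 < e -> exists2 S, A S & `|T - S| < e.
Proof.
split=> [AT e e0|AT B].
  have [S [AS TS]] := AT _ (nbhsx_ballx T e e0).
  by exists S => //; move: TS; rewrite -ball_normE.
move=> /nbhs_ballP[e /= e0 TB]; have [S AS TS] := AT e e0.
by exists S; split => //; apply: TB; rewrite -ball_normE.
Qed.

Definition opcoef T (x y : X) : R[i] := T (delta p1 y) x.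

End OpNorm.

Section Roe.
Variables (R : realType) (X : metricType R) (p : R) (p1 : 1 <= p).
Local Notation bop := (bop X p1).
Implicit Types S T : bop.

(* The maximum with 0 makes the supremum range over [0, +oo], i.e. it sends   *)
(* an operator with no nonzero entry to 0 and not to -oo.                     *)
Definition propagation T : \bar R := maxe 0%E
  (ereal_sup [set e | exists x y, opcoef T x y != 0 /\ e = (mdist x y)%:E]).

Definition finite_propagation : set bop := [set T | (propagation T < +oo)%E].

Lemma finite_propagationP T : finite_propagation T <->
  exists r : R, forall x y, opcoef T x y != 0 -> mdist x y <= r.
Proof.
rewrite /finite_propagation/= /propagation; split=> [|[r rT]].
  rewrite gt_max => /andP[_]; set s := ereal_sup _ => soo.
  exists (fine s) => x y Txy.
  have xys : ((mdist x y)%:E <= s)%E by apply: ereal_sup_ubound; exists x, y.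
  rewrite -lee_fin fineK// fin_numE; apply/andP; split.
    by apply: contraTN xys => /eqP ->.
  by rewrite lt_eqF.
rewrite gt_max ltry/=; apply: le_lt_trans (ltry r).
by apply: ge_ereal_sup => _ [x [y [Txy ->]]]; rewrite lee_fin rT.
Qed.

Lemma opcoef_sum T (f : lp X p1) x :
  (forall y, f y != 0 -> opcoef T x y = 0) -> T f x = 0.
Proof.
move=> fT; apply/eq0_normc/eqP; rewrite eq_le normc_ge0 andbT.
apply/ler_addgt0Pr => e e0; rewrite add0r.
have d0 : 0 < e / (opnorm T + 1).
  by rewrite divr_gt0// ltr_wpDl// opnorm_ge0.
have [s us hs] := lp_approx f d0.
have gx : T (\sum_(y <- s) f y *: delta p1 y) x = 0.
  rewrite linear_sum; elim: {us hs} s => [|y s ih]; first by rewrite big_nil.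
  rewrite big_cons -[LHS]/((T (f y *: delta p1 y)) x + (\sum_(j <- s) T (f j *: delta p1 j)) x).
  rewrite ih addr0 linearZ -[LHS]/(f y * opcoef T x y).
  by have [->|/fT ->] := eqVneq (f y) 0; rewrite ?mul0r ?mulr0.
have -> : T f x = T (f - \sum_(y <- s) f y *: delta p1 y) x.
  rewrite linearB -[RHS]/(T f x - T (\sum_(y <- s) f y *: delta p1 y) x).
  by rewrite gx subr0.
apply: le_trans (lp_norm_ge _ _) _; apply: le_trans (opnormP T _) _.
apply: (@le_trans _ _ (opnorm T * (e / (opnorm T + 1)))).
  by rewrite ler_wpM2l ?opnorm_ge0.
have := opnorm_ge0 T => T0.
rewrite mulrCA ger_pMr// ler_pdivrMr ?mul1r ?lerDl// ltr_wpDl//.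
Qed.

Lemma finite_propagation1 : finite_propagation 1.
Proof.
apply/finite_propagationP; exists 0 => x y.
rewrite -[opcoef _ _ _]/((x == y)%:R : R[i]).
by have [->|] := eqVneq x y; rewrite ?mdistxx// eqxx.
Qed.

Lemma finite_propagationB S T :
  finite_propagation S -> finite_propagation T -> finite_propagation (S - T).
Proof.
move=> /finite_propagationP[r rS] /finite_propagationP[s sT].
apply/finite_propagationP; exists (Num.max r s) => x y.
rewrite -[opcoef _ _ _]/(opcoef S x y - opcoef T x y) le_max => ST.
have [S0|/rS->//] := eqVneq (opcoef S x y) 0.
by rewrite sT ?orbT//; apply: contra ST => /eqP ->; rewrite S0 subr0.
Qed.

Lemma finite_propagationM S T :
  finite_propagation S -> finite_propagation T -> finite_propagation (S * T).
Proof.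
move=> /finite_propagationP[r rS] /finite_propagationP[s sT].
apply/finite_propagationP; exists (r + s) => x z.
apply: contraNT; rewrite -ltNge => xz.
apply/eqP/(@opcoef_sum S (T (delta p1 z)) x) => y Tyz.
apply/eqP; apply: contraTT xz => Sxy.
rewrite -leNgt; apply: le_trans (metric_triangle x y z) _.
exact: lerD (rS _ _ Sxy) (sT _ _ Tyz).
Qed.

(* `closure` is taken for the operator norm topology on `bop X p1`, induced   *)
(* by `opnorm`; see `closure_bopP`.                                           *)
Definition roe_pred : {pred bop} := fun T => `[< closure finite_propagation T >].

Lemma roe_subring_closed : subring_closed roe_pred.
Proof.
split=> [|S T|S T].
- apply/asboolP/closure_bopP => e e0; exists 1; first exact: finite_propagation1.
  by rewrite subrr normr0.
- move=> /asboolP/closure_bopP hS /asboolP/closure_bopP hT.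
  apply/asboolP/closure_bopP => e e0; have e20 : 0 < e / 2 by rewrite divr_gt0.
  have [S' fS SS'] := hS _ e20; have [T' fT TT'] := hT _ e20.
  exists (S' - T'); first exact: finite_propagationB.
  have -> : S - T - (S' - T') = (S - S') - (T - T').
    by rewrite !opprB [T' - S']addrC addrACA [- T + T']addrC.
  apply: le_lt_trans (ler_normB _ _) _; rewrite [ltRHS]splitr.
  exact: ltrD.
- move=> /asboolP/closure_bopP hS /asboolP/closure_bopP hT.
  apply/asboolP/closure_bopP => e e0.
  have d0 : 0 < e / 2 / (`|T| + 1) by rewrite !divr_gt0// ltr_wpDl.
  have [S' fS SS'] := hS _ d0.
  have d'0 : 0 < e / 2 / (`|S'| + 1) by rewrite !divr_gt0// ltr_wpDl.
  have [T' fT TT'] := hT _ d'0.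
  exists (S' * T'); first exact: finite_propagationM.
  have -> : S * T - S' * T' = (S - S') * T + S' * (T - T').
    by rewrite mulrBl mulrBr addrA subrK.
  apply: le_lt_trans (ler_normD _ _) _; rewrite [ltRHS]splitr.
  apply: ltr_leD; apply: le_trans (ler_bopM _ _) _ || apply: le_lt_trans (ler_bopM _ _) _.
    apply: (@le_lt_trans _ _ (e / 2 / (`|T| + 1) * `|T|)).
      by rewrite ler_wpM2r// ltW.
    by rewrite -[ltRHS](@divfK _ (`|T| + 1)) ?gt_eqF ?ltr_wpDl// ltr_pM2l// ltrDl.
  apply: (@le_trans _ _ (`|S'| * (e / 2 / (`|S'| + 1)))).
    by rewrite ler_wpM2l// ltW.
  rewrite mulrC -[leRHS](@divfK _ (`|S'| + 1)) ?gt_eqF ?ltr_wpDl//.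
  by rewrite ler_pM2l// lerDl.
Qed.

HB.instance Definition _ := GRing.isSubringClosed.Build bop roe_pred
  roe_subring_closed.

Record uniform_roe := UniformRoe {
  uniform_roe_val :> bop; uniform_roe_valP : uniform_roe_val \in roe_pred }.

HB.instance Definition _ := [isSub for uniform_roe_val].
HB.instance Definition _ := [Choice of uniform_roe by <:].
HB.instance Definition _ :=
  GRing.SubChoice_isSubPzRing.Build bop roe_pred uniform_roe
    roe_subring_closed.
End Roe.

Section Coarse.
Variable R : realType.
Implicit Types X Y : metricType R.

Definition uniformly_expansive X Y (f : X -> Y) : Prop :=
  forall r : R, 0 < r -> exists2 s : R, 0 < s &
    forall x1 x2, mdist x1 x2 <= r -> mdist (f x1) (f x2) <= s.

Definition close_maps X Y (f g : X -> Y) : Prop :=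
  exists2 c : R, 0 < c & forall x, mdist (f x) (g x) <= c.

Definition coarsely_equivalent X Y : Prop :=
  exists (f : X -> Y) (g : Y -> X),
    [/\ uniformly_expansive f, uniformly_expansive g,
        close_maps (f \o g) id & close_maps (g \o f) id].

End Coarse.

Definition subgroup_generated (G : groupType) (S : set G) : set G :=
  smallest (fun H : set G => group_closed (mem H)) S.

Definition locally_finite (G : groupType) : Prop :=
  forall S : set G, finite_set S -> finite_set (subgroup_generated S).

#[short(type="metricGroupType")]
HB.structure Definition MetricGroup (R : numFieldType) :=
  {G of Group G & Metric R G}.

Section MetricGroup.
Variables (R : realType) (G : metricGroupType R).

Definition left_invariant_metric : Prop :=
  forall g x y : G, mdist (g * x)%g (g * y)%g = mdist x y.

Definition proper_metric : Prop :=
  forall (x : G) (r : R), finite_set [set y : G | mdist x y <= r].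

End MetricGroup.

Definition isomorphic_groups (U V : zmodType) : Prop :=
  exists f : {additive U -> V}, bijective f.

(* Main.v *)
Require Import Defs.
From HB Require Import structures.
From mathcomp Require Import all_boot all_order all_algebra generic_quotient.
From mathcomp Require Import complex.
From mathcomp Require Import all_classical all_reals all_analysis.
From mathcomp Require Import ring lra zify.

Set Implicit Arguments.
Unset Strict Implicit.
Unset Printing Implicit Defensive.

Import Order.TTheory GRing.Theory Num.Theory.
Import numFieldNormedType.Exports.
Import Normc.
Local Open Scope classical_set_scope.
Local Open Scope ring_scope.

(** The theorem rests on a dichotomy: any two infinite groups of the kind
considered are coarsely equivalent, any two finite ones trivially so, and K_0
tells the two cases apart.

Coarse equivalence implies isomorphism ([coarse_K0]).  A coarse equivalence
f from X to Y whose fibres are coloured by a finite set K, distinct points of a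
fibre having distinct colours, splits into partial bijections s_k, k in K.  The
operators V_k that they induce on the l^p spaces turn T into the K x K matrix
of entries V_k T V_l^-1, which gives a multiplicative map from the Roe algebra
of X to matrices over that of Y.  Doing the same with a coarse inverse and
composing, one gets an inner amplification, because g o f is close to the
identity; hence inverse isomorphisms on K_0 ([K0_morita]).  Properness and left
invariance of the metric bound the fibres and supply the colours
([fibre_colouring]).

Finite and infinite groups are separated by divisibility.  For a finite group
the Roe algebra is a full matrix algebra, so K_0 is that of the field of
complex numbers, which is infinite cyclic: no nonzero element is divisible by
arbitrarily large integers ([finite_space_K0], [K0_field_not_divisible]).  For
an infinite group the class of the unit is such an element.  It is divisible by
the order of every finite subgroup H, since the unit is a sum of |H| orthogonal
translates of the projection onto a transversal of H
([roe_K0_unit_divisible]).  It is nonzero: if a multiple n[1] vanished, then n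
would be a finite sum of commutators ([K0_unit_commutators]), whereas the
normalised traces over finite subgroups vanish asymptotically on commutators
([roe_trace_comm]), since an operator of finite propagation is block diagonal
for the cosets of every sufficiently large finite subgroup.

For the coarse equivalence of two infinite groups, each of them is identified
with the natural numbers in such a way that the cosets of a chain of finite
subgroups become the blocks of consecutive integers of lengths N_0 = 1, N_1,
N_2, and so on, each length dividing the next ([group_block_enumeration]).
Bounded distance then means lying in a common block.  Given two such chains N
and M, one passes to subsequences n and m and builds a strictly increasing
beta on the natural numbers such that n_k divides beta (j m_k) for all j, and
every multiple of n_(k+1) is of the form beta (j m_k) ([interleaving]).  In
other words the boundaries of the two block structures alternate:
boundaries of n_(k+1)-blocks are images of boundaries of m_k-blocks, which are
boundaries of n_k-blocks.  So beta and its left inverse, the largest y with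
beta y <= x, are mutually inverse coarse equivalences ([blocks_coarse]).  The
map beta is found by recording its increments in enumerates, and the freedom left by
the choice of subsequences reduces the whole construction to keeping an
interval [lo, hi] of admissible sizes with lo < hi ([balanced_exists]). *)

(** * Interleaving two divisor chains *)

Section Interleaving.
Local Open Scope nat_scope.

Definition divisor_chain (N : nat -> nat) : Prop :=
  N 0 = 1 /\ forall k, exists2 b, 1 < b & N k.+1 = b * N k.

Lemma divisor_chain_gt0 N k : divisor_chain N -> 0 < N k.
Proof.
move=> [N0 NS]; elim: k => [|k ih]; first by rewrite N0.
by have [b b1 ->] := NS k; rewrite muln_gt0 ih (ltn_trans _ b1).
Qed.

Lemma divisor_chain_step N k t : divisor_chain N ->
  exists2 a, t < a & N (k + t) = a * N k.
Proof.
move=> NP; elim: t => [|t [a ta NE]]; first by exists 1; rewrite ?addn0 ?mul1n.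
have [b b1 bE] := NP.2 (k + t); exists (b * a).
  by rewrite (leq_ltn_trans ta) // ltn_Pmull // (leq_ltn_trans _ ta).
by rewrite addnS bE NE mulnA.
Qed.

Lemma divisor_chain_dvd N k l : divisor_chain N -> k <= l -> N k %| N l.
Proof.
by move=> NP kl; rewrite -(subnKC kl);
  have [a _ ->] := divisor_chain_step k (l - k) NP; rewrite dvdn_mull.
Qed.

Lemma divisor_chain_gt N k : divisor_chain N -> k < N k.
Proof.
move=> NP; have [a ka] := divisor_chain_step 0 k NP.
by rewrite add0n NP.1 muln1 => ->.
Qed.

Lemma leq_homo_ltn (f : nat -> nat) : {homo f : k l / k < l} ->
  forall k, k <= f k.
Proof. by move=> fS; elim=> // k ih; apply: leq_ltn_trans ih _; exact: fS. Qed.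

Lemma split_sum lo hi s a : s * lo <= a <= s * hi ->
  exists w, [/\ size w = s, sumn w = a & all (fun x => lo <= x <= hi) w].
Proof.
elim: s a => [|s ih] a /andP[loa ahi].
  by exists [::]; split => //=; lia.
have lh : lo <= hi by rewrite -(@leq_pmul2l s.+1) // (leq_trans loa).
have slh : s * lo <= s * hi by rewrite leq_mul2l lh orbT.
rewrite !mulSn in loa ahi.
pose x := maxn lo (a - s * hi).
have [|w [ws wa wl]] := ih (a - x); first by rewrite /x; lia.
exists (x :: w); split => /=; rewrite ?ws ?wa ?wl ?andbT //; rewrite /x; lia.
Qed.

Lemma split_sum_head lo hi s a h : lo <= h <= hi -> h <= a ->
  s * lo <= a - h <= s * hi ->
  exists w, [/\ size w = s.+1, sumn w = a,
    all (fun x => lo <= x <= hi) w & head 0 w = h].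
Proof.
move=> hb ha /split_sum[w [ws wa wl]]; exists (h :: w).
by split => //=; rewrite ?ws ?wa ?wl ?subnKC ?hb.
Qed.

(** The arithmetic that carries an interval [lo, hi] of admissible sizes from
one level of the construction to the next.  A number s of summands in [lo, hi]
can add up to a for every s in [p, q], and a number r of summands in [p, q] can
add up to b for every r in [lo', hi'].  The inequalities with predecessors allow
the extreme case: q summands for a of which one is lo, and lo' summands for b of
which one is q. *)
Definition balanced lo hi a b lo' hi' : Prop := exists p q,
  [/\ 0 < p < q, q * lo <= a <= p * hi, a <= q.-1 * hi + lo,
      hi' * p <= b <= lo' * q & lo'.-1 * p + q <= b].

Lemma ceil_lt_floor x y c : 0 < x < y -> 4 * x * y <= c ->
  (c + y.-1) %/ y < c %/ x.
Proof.
move=> /andP[x0 xy] xyc; have y0 : 0 < y by exact: ltn_trans xy.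
set d := (c + _) %/ y; set e := c %/ x.
have dy : d * y <= c + y.-1 by exact: leq_trunc_div.
have cx : c < e.+1 * x by rewrite -ltn_divLR.
rewrite ltnNge; apply/negP => ed.
have h1 : e.+1 * x <= d.+1 * x by rewrite leq_mul2r ltnS ed orbT.
have h2 : d * x.+1 <= d * y by rewrite leq_mul2l xy orbT.
rewrite mulSn mulnSr in h1 h2.
have d2y : d.+1 <= 2 * y by lia.
have : d.+1 * x <= 2 * y * x by rewrite leq_mul2r d2y orbT.
rewrite mulSn -mulnA [y * x]mulnC.
have : 0 < x * y by rewrite muln_gt0 x0.
move: xyc; rewrite -mulnA; lia.
Qed.

(** Take p and lo' to be upper integer parts of a/hi and b/q, and q and hi' to
be lower integer parts of a/lo and b/p.  Since lo < hi, the interval [a/hi, a/lo]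
is as long as desired for large a, so that p < q in spite of the rounding; the
same argument then gives lo' < hi' for large b. *)
Lemma balanced_exists lo hi : 0 < lo < hi -> exists A, forall a, A <= a ->
  exists B, forall b, B <= b -> exists lo' hi',
    0 < lo' < hi' /\ balanced lo hi a b lo' hi'.
Proof.
move=> lohi; have /andP[lo0 lh] := lohi.
have hi0 : 0 < hi by exact: ltn_trans lh.
exists (4 * lo * hi) => a Aa.
pose p := (a + hi.-1) %/ hi; pose q := a %/ lo.
have pq : p < q by exact: ceil_lt_floor.
have p0 : 0 < p.
  rewrite divn_gt0 // -(prednK hi0) -addn1 [_ + 1]addnC leq_add2r.
  by apply: leq_trans Aa; rewrite !muln_gt0 lo0 hi0.
have q0 : 0 < q by exact: ltn_trans pq.
exists (4 * p * q + q * q) => b Bb.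
pose lo' := (b + q.-1) %/ q; pose hi' := b %/ p.
have lh' : lo' < hi'.
  by apply: ceil_lt_floor; rewrite ?p0 // (leq_trans _ Bb) ?leq_addr.
have qqb : q * q <= b by apply: leq_trans Bb; exact: leq_addl.
have lo'0 : 0 < lo'.
  rewrite divn_gt0 // -(prednK q0) -addn1 [_ + 1]addnC leq_add2r.
  by apply: leq_trans qqb; rewrite muln_gt0 q0.
have q1 : q * lo <= a by exact: leq_trunc_div.
have p2 : a + hi.-1 < p.+1 * hi by rewrite -ltn_divLR.
have l1 : lo' * q <= b + q.-1 by exact: leq_trunc_div.
have l2 : b + q.-1 < lo'.+1 * q by rewrite -ltn_divLR.
have h1 : hi' * p <= b by exact: leq_trunc_div.
have ap : a <= p * hi by move: p2; rewrite mulSn; lia.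
exists lo', hi'; split; first by rewrite lo'0.
exists p, q; split; first by rewrite p0.
- by rewrite q1.
- apply: leq_trans ap (leq_trans _ (leq_addr _ _)).
  by rewrite leq_mul2r -ltnS prednK // pq orbT.
- by rewrite h1; move: l2; rewrite mulSn; lia.
- have h2 : lo'.-1 * q < b.
    by move: l1; rewrite -{1}(prednK lo'0) mulSn; lia.
  rewrite -(leq_pmul2r q0) mulnDl -mulnA [p * q]mulnC mulnA.
  have h3 : lo'.-1 * q * p <= b.-1 * p.
    by rewrite leq_mul2r -ltnS prednK ?h2 ?orbT // (leq_ltn_trans _ h2).
  have h4 : b.-1 * p <= b.-1 * q.-1.
    by rewrite leq_mul2l -ltnS prednK // pq orbT.
  apply: leq_trans (leq_add (leq_trans h3 h4) qqb) _.
  have b0 : 0 < b by apply: leq_trans qqb; rewrite muln_gt0 q0.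
  rewrite -[X in _ <= b * X](prednK q0) mulnSr leq_add2r leq_mul2r.
  by rewrite leq_pred orbT.
Qed.

(** A list w of positive numbers encodes a finite increasing sequence, its
partial sums.  Here the sequence sends multiples of m to multiples of n. *)
Definition sums_dvd (m n : nat) (w : seq nat) : Prop :=
  forall j, j * m <= size w -> n %| sumn (take (j * m) w).

(** Every multiple of n in the range of the partial sums of w is the partial sum
at some multiple of m. *)
Definition sums_hit (m n : nat) (w : seq nat) : Prop :=
  forall i, i * n <= sumn w ->
  exists2 j, j * m <= size w & sumn (take (j * m) w) = i * n.

Lemma sums_dvd_cat m n w1 w2 : 0 < m -> m %| size w1 ->
  sums_dvd m n w1 -> sums_dvd m n w2 -> sums_dvd m n (w1 ++ w2).
Proof.
move=> m0 /dvdnP[s ws] d1 d2 j; rewrite size_cat take_cat ws => jw.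
case: ltnP => js; first by apply: d1; rewrite ws ltnW.
rewrite sumn_cat -mulnBl dvdn_add //; last by apply: d2; rewrite mulnBl leq_subLR.
by have := d1 s; rewrite -ws take_size; apply.
Qed.

Lemma sums_hit_cat m n w1 w2 : 0 < m -> 0 < n -> m %| size w1 -> n %| sumn w1 ->
  sums_hit m n w1 -> sums_hit m n w2 -> sums_hit m n (w1 ++ w2).
Proof.
move=> m0 n0 /dvdnP[s ws] /dvdnP[t wt] h1 h2 i; rewrite sumn_cat wt => iw.
have [it|ti] := leqP (i * n) (t * n).
  have [|j jw jE] := h1 i; first by rewrite wt.
  exists j; first by rewrite size_cat (leq_trans jw) ?leq_addr.
  by rewrite takel_cat.
have [|j jw jE] := h2 (i - t); first by rewrite mulnBl leq_subLR.
exists (s + j); first by rewrite size_cat ws mulnDl leq_add2l.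
rewrite mulnDl -ws take_cat ltnNge leq_addr /= addKn sumn_cat wt jE mulnBl subnKC //.
exact: ltnW.
Qed.

Lemma sums_dvd_nil m n : sums_dvd m n [::].
Proof. by move=> j _ /=. Qed.

Lemma sums_hit_nil m n : 0 < n -> sums_hit m n [::].
Proof.
by move=> n0 i; rewrite leqn0 muln_eq0 (gtn_eqF n0) orbF => /eqP ->; exists 0.
Qed.

Lemma sums_dvd_flatten m n (ws : seq (seq nat)) : 0 < m ->
  (forall w, w \in ws -> m %| size w) ->
  (forall w, w \in ws -> sums_dvd m n w) -> sums_dvd m n (flatten ws).
Proof.
move=> m0; elim: ws => [|w ws ih] ws1 ws2 /=; first exact: sums_dvd_nil.
apply: sums_dvd_cat; [by []|apply: ws1|apply: ws2|]; rewrite ?mem_head //.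
by apply: ih => v vw; [apply: ws1|apply: ws2]; rewrite inE vw orbT.
Qed.

Lemma sums_hit_flatten m n (ws : seq (seq nat)) : 0 < m -> 0 < n ->
  (forall w, w \in ws -> m %| size w) ->
  (forall w, w \in ws -> n %| sumn w) ->
  (forall w, w \in ws -> sums_hit m n w) -> sums_hit m n (flatten ws).
Proof.
move=> m0 n0; elim: ws => [|w ws ih] ws1 ws2 ws3 /=; first exact: sums_hit_nil.
apply: sums_hit_cat; [by []|by []|apply: ws1|apply: ws2|apply: ws3|];
  rewrite ?mem_head //.
by apply: ih => v vw; [apply: ws1|apply: ws2|apply: ws3]; rewrite inE vw orbT.
Qed.

Lemma size_flatten_const (T : eqType) s (ws : seq (seq T)) :
  (forall w, w \in ws -> size w = s) -> size (flatten ws) = size ws * s.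
Proof.
elim: ws => //= w ws ih wsP; rewrite size_cat ih ?wsP ?mem_head ?mulSn //.
by move=> v vw; rewrite wsP // inE vw orbT.
Qed.

Lemma sumn_flatten_map (F : nat -> seq nat) c (rs : seq nat) :
  (forall r, r \in rs -> sumn (F r) = r * c) ->
  sumn (flatten (map F rs)) = sumn rs * c.
Proof.
elim: rs => //= r rs ih rsP; rewrite sumn_cat ih ?rsP ?mem_head ?mulnDl //.
by move=> v vw; rewrite rsP // inE vw orbT.
Qed.

Section Tower.
Variables n m lo hi : nat -> nat.
Hypothesis n0 : n 0 = 1.
Hypothesis m0 : m 0 = 1.
Hypothesis n_gt : forall k, k < n k.
Hypothesis m_gt : forall k, k < m k.
Hypothesis nm : forall k, exists a b, [/\ n k.+1 = a * n k, m k.+1 = b * m k,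
  0 < lo k < hi k & balanced (lo k) (hi k) a b (lo k.+1) (hi k.+1)].

(** The increments, on a block of length m_k, of an initial piece of the map
that is being constructed: the image of the block is covered by r blocks of
length n_k, and up to level k the boundaries of the two block structures
alternate. *)
Definition gap_list k r (w : seq nat) : Prop :=
  [/\ size w = m k, sumn w = r * n k, all (fun x => 0 < x) w,
      forall l, l <= k -> sums_dvd (m l) (n l) w &
      forall l, l < k -> sums_hit (m l) (n l.+1) w].

Lemma dvd_n l k : l <= k -> n l %| n k.
Proof.
move=> lk; rewrite -(subnKC lk); elim: (k - l) => [|d ih]; first by rewrite addn0.
by rewrite addnS; have [a [b [-> _ _ _]]] := nm (l + d); rewrite dvdn_mull.
Qed.

Lemma dvd_m l k : l <= k -> m l %| m k.
Proof.
move=> lk; rewrite -(subnKC lk); elim: (k - l) => [|d ih]; first by rewrite addn0.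
by rewrite addnS; have [a [b [_ -> _ _]]] := nm (l + d); rewrite dvdn_mull.
Qed.

Definition gap_family k (F : nat -> seq nat) : Prop :=
  forall r, lo k <= r <= hi k -> gap_list k r (F r).

Lemma gap_family0 : gap_family 0 (fun r => [:: r]).
Proof.
have [a [b [_ _ /andP[l0 _] _]]] := nm 0.
move=> r /andP[lr _]; split => //=; rewrite ?m0 ?n0 ?addn0 ?muln1 ?andbT //.
  exact: leq_trans lr.
by move=> l; rewrite leqn0 => /eqP -> j _; rewrite n0 dvd1n.
Qed.

(** A piece of level k+1 covering r blocks of length n_(k+1) is glued from b
pieces of level k.  The list sigma says how: its i-th member lists the numbers of
n_k-blocks covered by those pieces that make up the i-th n_(k+1)-block, which is
why these numbers have sum a.  In this way the boundaries of n_(k+1)-blocks are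
hit at boundaries of m_k-blocks. *)
Lemma gap_list_step k F r (sigma : seq (seq nat)) a b : gap_family k F ->
  n k.+1 = a * n k -> m k.+1 = b * m k ->
  size sigma = r -> size (flatten sigma) = b ->
  (forall s, s \in sigma -> sumn s = a /\ all (fun x => lo k <= x <= hi k) s) ->
  gap_list k.+1 r (flatten (map F (flatten sigma))).
Proof.
move=> FP nE mE sr sb sP.
have sP' x : x \in flatten sigma -> lo k <= x <= hi k.
  by move=> /flattenP[s /sP[_ /allP sl] /sl].
have FP' x : x \in flatten sigma -> gap_list k x (F x) by move=> /sP'; exact: FP.
have memF w : w \in map F (flatten sigma) -> exists x, gap_list k x w.
  by move=> /mapP[x /FP' xP ->]; exists x.
have m_gt0 l : 0 < m l by exact: leq_ltn_trans (m_gt l).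
have n_gt0 l : 0 < n l by exact: leq_ltn_trans (n_gt l).
have sizeW : size (flatten (map F (flatten sigma))) = m k.+1.
  rewrite (size_flatten_const (s := m k)) ?size_map ?sb ?mE //.
  by move=> w /memF[x []].
have sumW : sumn (flatten (map F (flatten sigma))) = r * n k.+1.
  rewrite (sumn_flatten_map (c := n k)); last by move=> x /FP'[].
  rewrite nE mulnA -sr; congr (_ * _).
  elim: (sigma) sP => //= s t ih sP1; rewrite sumn_cat mulSn.
  rewrite (sP1 s (mem_head _ _)).1 ih // => u ut; apply: sP1.
  by rewrite inE ut orbT.
split=> //.
- apply/allP => x /flattenP[w /memF[y [_ _ /allP wy _ _]] /wy].
  exact.
- move=> l; rewrite leq_eqVlt => /orP[/eqP -> j|lk].
    (* At the new level the only multiples to look at are 0 and 1. *)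
    rewrite sizeW -{2}[m k.+1]mul1n leq_pmul2r //.
    case: j => [|[|//]] _; first by rewrite mul0n take0 dvdn0.
    by rewrite mul1n -sizeW take_size sumW dvdn_mull.
  apply: sums_dvd_flatten => // w /memF[x [ws _ _ wd _]]; last exact: wd.
  by rewrite ws dvd_m.
- move=> l; rewrite ltnS leq_eqVlt => /orP[/eqP ->|lk]; last first.
    apply: sums_hit_flatten => // w /memF[x [ws wn _ _ wh]].
    + by rewrite ws dvd_m // ltnW.
    + by rewrite wn dvdn_mull // dvd_n.
    + exact: wh.
  have -> : flatten (map F (flatten sigma)) =
      flatten (map (fun s => flatten (map F s)) sigma).
    by elim: (sigma) => //= s t ih; rewrite map_cat flatten_cat ih.
  have piece s : s \in sigma -> size (flatten (map F s)) = size s * m k /\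
      sumn (flatten (map F s)) = n k.+1.
    move=> ss; have [sa /allP sl] := sP s ss; split.
      rewrite (size_flatten_const (s := m k)) ?size_map //.
      by move=> w /mapP[x /sl xl ->]; have [] := FP x xl.
    rewrite (sumn_flatten_map (c := n k)) ?sa ?nE //.
    by move=> x /sl xl; have [] := FP x xl.
  apply: sums_hit_flatten => // w /mapP[s /piece[sz sm] ->].
  + by rewrite sz dvdn_mull.
  + by rewrite sm.
  + move=> i; rewrite sm -{2}[n k.+1]mul1n leq_pmul2r //.
    case: i => [|[|//]] _; first by exists 0; rewrite ?mul0n ?take0.
    by exists (size s); rewrite -?sz ?take_size ?mul1n.
Qed.

(** The prefix condition, which makes the passage to the limit possible, is met
by letting the extreme piece of level k+1, with r = lo_(k+1), begin with the
extreme piece of level k.  This is where the extra inequalities of [balanced]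
are used. *)
Lemma gap_family_step k F : gap_family k F ->
  exists2 G, gap_family k.+1 G & prefix (F (lo k)) (G (lo k.+1)).
Proof.
move=> FP; have [a [b [nE mE /andP[l0 lh] bal]]] := nm k.
have [p [q [/andP[p0 pq] /andP[qa ap] aq /andP[hb bl] lb]]] := bal.
have [a' [b' [_ _ /andP[l0' lh'] _]]] := nm k.+1.
have part s : p <= s <= q -> exists w, [/\ size w = s, sumn w = a &
    all (fun x => lo k <= x <= hi k) w].
  move=> /andP[ps sq]; apply: split_sum; apply/andP; split.
    by apply: leq_trans qa; rewrite leq_mul2r sq orbT.
  by apply: leq_trans ap _; rewrite leq_mul2r ps orbT.
have q0 : 0 < q by exact: ltn_trans pq.
have parts (ss : seq nat) : all (fun s => p <= s <= q) ss ->
    exists sigma : seq (seq nat), [/\ size sigma = size ss,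
      size (flatten sigma) = sumn ss &
      forall s, s \in sigma -> sumn s = a /\ all (fun x => lo k <= x <= hi k) s].
  elim: ss => [|s ss ih] /=; first by exists [::].
  move=> /andP[/part[w [ws wa wl]] /ih[sg [sg1 sg2 sg3]]].
  exists (w :: sg); split=> /=; rewrite ?sg1 ?size_cat ?ws ?sg2 //.
  by move=> v; rewrite inE => /orP[/eqP -> //|/sg3].
have [/= w0 [w0s w0a w0l w0h]] : exists w, [/\ size w = q.-1.+1, sumn w = a,
    all (fun x => lo k <= x <= hi k) w & head 0 w = lo k].
  have qE : q * lo k = lo k + q.-1 * lo k by rewrite -mulSn prednK.
  apply: split_sum_head; first by rewrite leqnn ltnW.
    by apply: leq_trans qa; rewrite qE leq_addr.
  by rewrite leq_subRL ?leq_subLR -?qE ?qa 1?addnC // (leq_trans _ qa) // qE leq_addr.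
have /choice[G GP] : forall r, exists w, lo k.+1 <= r <= hi k.+1 ->
    gap_list k.+1 r w /\ (r = lo k.+1 -> prefix (F (lo k)) w).
  move=> r; have [rb|rb] := boolP (lo k.+1 <= r <= hi k.+1); last by exists [::].
  have [->|rl] := eqVneq r (lo k.+1).
    have [ss [ss1 ss2 ss3]] : exists ss, [/\ size ss = (lo k.+1).-1,
        sumn ss = b - q & all (fun s => p <= s <= q) ss].
      have lqE : lo k.+1 * q = q + (lo k.+1).-1 * q by rewrite -mulSn prednK.
      apply: split_sum; rewrite leq_subRL ?leq_subLR -?lqE ?bl 1?addnC ?lb //.
      by rewrite (leq_trans _ lb) ?leq_addl.
    have [sg [sg1 sg2 sg3]] := parts ss ss3.
    exists (flatten (map F (flatten (w0 :: sg)))) => _; split.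
      apply: gap_list_step nE mE _ _ _ => //=.
      - by rewrite sg1 ss1 prednK.
      - rewrite size_cat sg2 ss2 w0s prednK // subnKC //.
        by rewrite (leq_trans _ lb) ?leq_addl.
      - by move=> v; rewrite inE => /orP[/eqP -> //|/sg3].
    move=> _; case: (w0) w0s w0h => [|x w1 _ /= ->] //.
    exact: prefix_prefix.
  have [ss [ss1 ss2 ss3]] : exists ss, [/\ size ss = r,
      sumn ss = b & all (fun s => p <= s <= q) ss].
    move/andP: rb => [r1 r2]; apply: split_sum; apply/andP; split.
      by apply: leq_trans hb; rewrite leq_mul2r r2 orbT.
    by apply: leq_trans bl _; rewrite leq_mul2r r1 orbT.
  have [sg [sg1 sg2 sg3]] := parts ss ss3.
  exists (flatten (map F (flatten sg))) => _; split; last by move/eqP: rl.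
  by apply: gap_list_step nE mE _ _ _ => //; rewrite ?sg1 ?sg2.
exists G; first by move=> r /GP[].
by apply: (GP _ _).2 => //; rewrite leqnn ltnW.
Qed.

Lemma prefix_sumn_take (w1 w2 : seq nat) y : prefix w1 w2 -> y <= size w1 ->
  sumn (take y w2) = sumn (take y w1).
Proof. by move=> /prefixP[w ->] yw; rewrite takel_cat. Qed.

(** The pieces with r = lo_k are prefixes of one another, hence define an
infinite sequence of increments; beta is the sequence of its partial sums. *)
Lemma interleaving_tower : exists beta : nat -> nat,
  [/\ beta 0 = 0, {homo beta : x y / x < y},
      forall k j, n k %| beta (j * m k) &
      forall k i, exists j, beta (j * m k) = i * n k.+1].
Proof.
have /choice[step stepP] : forall x : nat * (nat -> seq nat), exists G,
    gap_family x.1 x.2 -> gap_family x.1.+1 G /\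
      prefix (x.2 (lo x.1)) (G (lo x.1.+1)).
  move=> [k F] /=; have [/gap_family_step[G ? ?]|] := pselect (gap_family k F).
    by exists G.
  by exists F.
pose F := fix F k := if k is k'.+1 then step (k', F k') else fun r => [:: r].
have FP k : gap_family k (F k).
  by elim: k => [|k ih]; [exact: gap_family0|exact: (stepP (k, F k) ih).1].
pose V k := F k (lo k).
have VS k : prefix (V k) (V k.+1) := (stepP (k, F k) (FP k)).2.
have Vle k l : k <= l -> prefix (V k) (V l).
  move=> kl; rewrite -(subnKC kl); elim: (l - k) => [|d ih].
    by rewrite addn0 prefix_refl.
  by rewrite addnS; exact: prefix_trans ih (VS _).
have lo_gt0 k : 0 < lo k by have [a [b [_ _ /andP[]]]] := nm k.
have Vgap k : gap_list k (lo k) (V k).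
  apply: FP; rewrite leqnn /=; have [a [b [_ _ /andP[_ /ltnW]]]] := nm k.
  exact.
have sizeV k : size (V k) = m k by have [] := Vgap k.
have sumV k : sumn (V k) = lo k * n k by have [] := Vgap k.
(* V y has length m_y > y, so that its first y entries make sense. *)
pose beta y := sumn (take y (V y)).
have betaE y k : y <= m k -> beta y = sumn (take y (V k)).
  move=> yk; have ym : y <= size (V y) by rewrite sizeV ltnW.
  have [/Vle yk'|/ltnW/Vle ky] := leqP y k; first by rewrite (prefix_sumn_take yk').
  by rewrite /beta (prefix_sumn_take ky) ?sizeV.
exists beta; split.
- by rewrite /beta take0.
- move=> x y xy; have ym : y <= m y by rewrite ltnW.
  rewrite (betaE y y) // (betaE x y) ?(leq_trans (ltnW xy)) //.
  rewrite -[take y _](cat_take_drop x) sumn_cat take_takel ?(ltnW xy) //.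
  rewrite -[ltnLHS]addn0 ltn_add2l.
  have [_ _ /allP V0 _ _] := Vgap y.
  case E: (drop x (take y (V y))) => [|z s] /=.
    have : size (drop x (take y (V y))) = 0 by rewrite E.
    by rewrite size_drop size_takel ?sizeV // => /eqP; rewrite subn_eq0 leqNgt xy.
  rewrite addn_gt0 V0 //; apply: (@mem_take y); apply: (@mem_drop x).
  by rewrite E mem_head.
- move=> k j; pose K := maxn k (j * m k).
  have jK : j * m k <= m K by rewrite (leq_trans (leq_maxr k _)) // ltnW.
  have [_ _ _ Vd _] := Vgap K.
  by rewrite (betaE _ K) //; apply: Vd; rewrite ?leq_maxl ?sizeV.
- move=> k i; pose K := maxn k.+1 (i * n k.+1).
  have [_ _ _ _ Vh] := Vgap K.
  have [||j jw jE] := Vh k _ i.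
  + exact: leq_maxl.
  + rewrite sumV (leq_trans (leq_maxr k.+1 _)) // (leq_trans (ltnW (n_gt K))) //.
    by rewrite leq_pmull.
  + by exists j; rewrite (betaE _ K) // -(sizeV K).
Qed.

End Tower.

(** Subsequences are chosen recursively, together with the intervals of
admissible sizes: ratios of terms of a divisor chain are as large as desired, so
[balanced_exists] applies at each step. *)
Lemma interleaving N M : divisor_chain N -> divisor_chain M ->
  exists (u v beta : nat -> nat),
  [/\ {homo u : k l / k < l}, {homo v : k l / k < l}, beta 0 = 0,
      {homo beta : x y / x < y} &
      (forall k j, N (u k) %| beta (j * M (v k))) /\
      (forall k i, exists j, beta (j * M (v k)) = i * N (u k.+1))].
Proof.
move=> NP MP; pose state := (nat * nat * nat * nat)%type.
pose next (x y : state) := let: (u, v, lo, hi) := x in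
  let: (u', v', lo', hi') := y in 0 < lo < hi ->
  [/\ u < u', v < v', 0 < lo' < hi' & exists a b,
    [/\ N u' = a * N u, M v' = b * M v & balanced lo hi a b lo' hi']].
have /choice[step stepP] : forall x, exists y, next x y.
  move=> [[[u v] lo] hi]; have [lh|lh] := boolP (0 < lo < hi); last first.
    by exists (0, 0, 0, 0) => /=; rewrite (negbTE lh).
  have [A AP] := balanced_exists lh.
  have [a Aa aE] := divisor_chain_step u A.+1 NP.
  have [B BP] := AP a (ltnW (ltnW Aa)).
  have [b Bb bE] := divisor_chain_step v B.+1 MP.
  have [lo' [hi' [lh' bal]]] := BP b (ltnW (ltnW Bb)).
  exists (u + A.+1, v + B.+1, lo', hi') => /= _.
  by split=> //; [rewrite addnS ltnS leq_addr|rewrite addnS ltnS leq_addr|exists a, b].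
(* The initial interval [1, 2] is the simplest one with 0 < lo < hi. *)
pose st k : state := iter k step (0, 0, 1, 2).
pose u k := (st k).1.1.1; pose v k := (st k).1.1.2.
pose lo k := (st k).1.2; pose hi k := (st k).2.
have stP k : 0 < lo k < hi k -> [/\ u k < u k.+1, v k < v k.+1,
    0 < lo k.+1 < hi k.+1 & exists a b, [/\ N (u k.+1) = a * N (u k),
      M (v k.+1) = b * M (v k) & balanced (lo k) (hi k) a b (lo k.+1) (hi k.+1)]].
  rewrite /u /v /lo /hi /= -/(st k); have := stepP (st k).
  by case: (st k) => [[[? ?] ?] ?]; case: (step _) => [[[? ?] ?] ?].
have lh k : 0 < lo k < hi k.
  by elim: k => [//|k ih]; have [] := stP k ih.
have uS : {homo u : k l / k < l}.
  by apply: homo_ltn; [exact: ltn_trans|move=> k; have [] := stP k (lh k)].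
have vS : {homo v : k l / k < l}.
  by apply: homo_ltn; [exact: ltn_trans|move=> k; have [] := stP k (lh k)].
have [|||||beta [b0 bS bd bh]] :=
  @interleaving_tower (N \o u) (M \o v) lo hi.
- exact: NP.1.
- exact: MP.1.
- by move=> k; apply: leq_ltn_trans (leq_homo_ltn uS k) _; exact: divisor_chain_gt.
- by move=> k; apply: leq_ltn_trans (leq_homo_ltn vS k) _; exact: divisor_chain_gt.
- by move=> k; have [_ _ _ [a [b [Na Mb bal]]]] := stP k (lh k); exists a, b.
by exists u, v, beta.
Qed.

End Interleaving.

(** * K-theory of rings: idempotents indexed by finite types *)

Local Open Scope quotient_scope.

(** Indexing idempotents by arbitrary finite types, instead of initial segments
of the natural numbers, turns direct sums and tensor products into sum types and
product types, with no renumbering. *)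
Section IndexedIdempotents.
Variable A : pzRingType.
Implicit Types I J : finType.

Definition idem_fun I (e : I -> I -> A) : Prop :=
  forall i k, \sum_j e i j * e j k = e i k.

Definition mvn_fun I J (e : I -> I -> A) (f : J -> J -> A) : Prop :=
  exists (u : I -> J -> A) (v : J -> I -> A),
    (forall i k, \sum_j u i j * v j k = e i k) /\
    (forall j l, \sum_i v j i * u i l = f j l).

Definition fun_mx I J (u : I -> J -> A) : 'M[A]_(#|I|, #|J|) :=
  \matrix_(i, j) u (enum_val i) (enum_val j).

Definition mx_fun I J (u : 'M[A]_(#|I|, #|J|)) : I -> J -> A :=
  fun i j => u (enum_rank i) (enum_rank j).

Lemma mx_funK I J (u : 'M[A]_(#|I|, #|J|)) : fun_mx (mx_fun u) = u.
Proof. by apply/matrixP => i j; rewrite mxE /mx_fun !enum_valK. Qed.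

Lemma fun_mxM I J (K : finType) (u : I -> J -> A) (v : J -> K -> A)
    (w : I -> K -> A) :
  fun_mx u *m fun_mx v = fun_mx w <->
  forall i k, \sum_j u i j * v j k = w i k.
Proof.
have sumE i k : (fun_mx u *m fun_mx v) i k =
    \sum_j u (enum_val i) j * v j (enum_val k).
  rewrite mxE (reindex _ (onW_bij _ (@enum_val_bij J))) /=.
  by apply: eq_bigr => j _; rewrite !mxE.
split=> [/matrixP uvw i k|uvw]; last first.
  by apply/matrixP => i k; rewrite sumE uvw mxE.
by have := uvw (enum_rank i) (enum_rank k); rewrite sumE mxE !enum_rankK.
Qed.

Lemma idem_fun_mx I (e : I -> I -> A) : idem_fun e -> fun_mx e *m fun_mx e = fun_mx e.
Proof. by move=> ee; apply/fun_mxM. Qed.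

Definition cls I (e : I -> I -> A) (ee : idem_fun e) : idem_classes A :=
  \pi_(idem_classes A) (mkidem (idem_fun_mx ee)).

Lemma clsP I J (e : I -> I -> A) (f : J -> J -> A) (ee : idem_fun e)
    (ff : idem_fun f) : cls ee = cls ff <-> mvn_fun e f.
Proof.
split=> [/idem_classesP[u [v [uv vu]]]|[u [v [uv vu]]]].
  exists (mx_fun u), (mx_fun v).
  by split; apply/fun_mxM; rewrite !mx_funK.
apply/idem_classesP; exists (fun_mx u), (fun_mx v).
by split; apply/fun_mxM.
Qed.

Lemma cls_surj (c : idem_classes A) :
  exists n (e : 'I_n -> 'I_n -> A) (ee : idem_fun e), c = cls ee.
Proof.
elim/quotW: c => e; pose n := tag (val e).
pose f : 'I_n -> 'I_n -> A := fun i j => idem_mx e i j.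
have ff : idem_fun f.
  move=> i k; have /matrixP/(_ i k) := idem_mxK e; rewrite mxE.
  exact.
exists n, f, ff; apply/idem_classesP.
pose u : 'M[A]_(n, #|'I_n|) := \matrix_(i, j) f i (enum_val j).
pose v : 'M[A]_(#|'I_n|, n) := \matrix_(i, j) f (enum_val i) j.
exists u, v; split; apply/matrixP => i k; rewrite !mxE.
  rewrite (reindex _ (onW_bij _ (@enum_rank_bij 'I_n))) /= -[RHS]ff.
  by apply: eq_bigr => j _; rewrite !mxE enum_rankK.
by rewrite -ff; apply: eq_bigr => j _; rewrite !mxE.
Qed.

Lemma mvn_fun_reindex I J (e : I -> I -> A) (s : J -> I) : idem_fun e ->
  bijective s -> mvn_fun e (fun a b => e (s a) (s b)).
Proof.
move=> ee sb; exists (fun i b => e i (s b)), (fun a j => e (s a) j).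
split=> [i k|a b]; last exact: ee.
by rewrite -ee [RHS](reindex s) //; exact: onW_bij.
Qed.

Definition block_fun I J (e : I -> I -> A) (f : J -> J -> A) : I + J -> I + J -> A :=
  fun a b => match a, b with
    | inl i, inl j => e i j | inr i, inr j => f i j | _, _ => 0 end.

Lemma idem_fun_sum I J (e : I -> I -> A) (f : J -> J -> A) :
  idem_fun e -> idem_fun f -> idem_fun (block_fun e f).
Proof.
move=> ee ff [i|i] [k|k]; rewrite big_sumType /=.
- by rewrite ee [X in _ + X]big1 ?addr0 // => j _; rewrite mul0r.
- by rewrite !big1 ?addr0 // => j _; rewrite ?mul0r ?mulr0.
- by rewrite !big1 ?addr0 // => j _; rewrite ?mul0r ?mulr0.
- by rewrite ff [X in X + _]big1 ?add0r // => j _; rewrite mul0r.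
Qed.

Lemma clsD I J (e : I -> I -> A) (f : J -> J -> A) (ee : idem_fun e)
    (ff : idem_fun f) : cls ee + cls ff = cls (idem_fun_sum ee ff).
Proof.
rewrite [LHS]idem_classes_addE; apply/idem_classesP.
set m := #|I|; set n := #|J|.
pose h (a : 'I_(m + n)) : I + J := match fintype.split a with
  | inl i => inl (enum_val i) | inr j => inr (enum_val j) end.
have hb : bijective h.
  exists (fun x => fintype.unsplit (match x with
    | inl i => inl (enum_rank i) | inr j => inr (enum_rank j) end)).
  - by move=> a; rewrite /h -[RHS]splitK; case: fintype.split => i; rewrite enum_valK.
  - by case=> i; rewrite /h unsplitK enum_rankK.
have gE i j : idem_mx (idem_sum (mkidem (idem_fun_mx ee)) (mkidem (idem_fun_mx ff)))
    i j = block_fun e f (h i) (h j).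
  by rewrite [idem_mx _]/= /h !mxE; case: fintype.split => k; rewrite !mxE;
     case: fintype.split => l; rewrite ?mxE.
have [u [v [uv vu]]] : mvn_fun (fun i j => block_fun e f (h i) (h j)) (block_fun e f).
  have [u [v [uv vu]]] := mvn_fun_reindex (idem_fun_sum ee ff) hb.
  by exists v, u.
exists (\matrix_(i, j) u i (enum_val j)), (\matrix_(i, j) v (enum_val i) j).
split; apply/matrixP => i k; rewrite ?gE !mxE -?uv -?vu.
  rewrite [RHS](reindex _ (onW_bij _ (@enum_val_bij _))) /=.
  by apply: eq_bigr => j _; rewrite !mxE.
by apply: eq_bigr => j _; rewrite !mxE.
Qed.

Lemma idem_fun0 : idem_fun (fun _ _ : void => 0 : A).
Proof. by case. Qed.

Lemma cls0 : cls idem_fun0 = 0.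
Proof.
apply/idem_classesP; exists 0, 0.
split; apply/matrixP => i; last by case: i.
by have := ltn_ord i; rewrite [X in (_ < X)%N]card_void.
Qed.

End IndexedIdempotents.
Arguments idem_fun0 {A}.
Arguments cls {A I e}.

(** The functoriality of the Grothendieck group, for isomorphisms. *)
Lemma groth_functor (M N : nmodType) (h : M -> N) :
  {morph h : x y / x + y} -> bijective h ->
  isomorphic_groups (groth M) (groth N).
Proof.
move=> hD [k hk kh].
have kD : {morph k : x y / x + y}.
  by move=> x y; apply: (can_inj hk); rewrite hD !kh.
pose F (M1 N1 : nmodType) (f : M1 -> N1) (a : groth M1) : groth N1 :=
  \pi_(groth N1) (f (repr a).1, f (repr a).2).
have FE (M1 N1 : nmodType) (f : M1 -> N1) (x : M1 * M1) :
    {morph f : x y / x + y} ->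
    F M1 N1 f (\pi_(groth M1) x) = \pi_(groth N1) (f x.1, f x.2).
  move=> fD; apply/grothP.
  have /grothP[s sP] := reprK (\pi_(groth M1) x).
  by exists (f s); rewrite /= -!fD sP.
have FB : zmod_morphism (F M N h).
  elim/quotW => x; elim/quotW => y.
  have -> : \pi_(groth M) x - \pi_(groth M) y =
      \pi_(groth M) (x.1 + y.2, x.2 + y.1).
    by rewrite -(groth_addE x (y.2, y.1)) -groth_oppE.
  rewrite !FE // !hD.
  by rewrite -(groth_addE (h x.1, h x.2) (h y.2, h y.1)) -(groth_oppE (h y.1, h y.2)).
have hkF : cancel (F M N h) (F N M k).
  by elim/quotW => x; rewrite (FE M N h) // (FE N M k) //= !hk -surjective_pairing.
have khF : cancel (F N M k) (F M N h).
  by elim/quotW => x; rewrite (FE N M k) // (FE M N h) //= !kh -surjective_pairing.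
pose Fm := GRing.isZmodMorphism.Build (groth M) (groth N) (F M N h) FB.
exists (HB.pack_for {additive groth M -> groth N} (F M N h) Fm).
exact: Bijective hkF khF.
Qed.

Section Amplification.
Variables (A B : pzRingType) (K : finType) (phi : K -> K -> A -> B).

(** A multiplicative additive map from A to K x K matrices over B, given by its
entries; it need not be unital. *)
Definition matrix_morphism : Prop :=
  (forall k l, {morph phi k l : a b / a + b}) /\
  (forall k m a b, \sum_l phi k l a * phi l m b = phi k m (a * b)).

Definition amplify (I J : finType) (u : I -> J -> A) : I * K -> J * K -> B :=
  fun p q => phi p.2 q.2 (u p.1 q.1).

Hypothesis phiP : matrix_morphism.

Lemma matrix_morphism0 k l : phi k l 0 = 0.
Proof. by apply: (addrI (phi k l 0)); rewrite -phiP.1 !addr0. Qed.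

Lemma matrix_morphism_sum k l (I : finType) (F : I -> A) :
  phi k l (\sum_i F i) = \sum_i phi k l (F i).
Proof. by apply: big_morph; [exact: phiP.1|exact: matrix_morphism0]. Qed.

Lemma amplifyM (I J L : finType) (u : I -> J -> A) (v : J -> L -> A)
    (w : I -> L -> A) : (forall i k, \sum_j u i j * v j k = w i k) ->
  forall p q, \sum_r amplify u p r * amplify v r q = amplify w p q.
Proof.
move=> uvw [i k] [l m]; rewrite /amplify /= -uvw matrix_morphism_sum.
under [RHS]eq_bigr => j _ do rewrite -phiP.2.
by rewrite pair_bigA.
Qed.

Lemma amplify_idem (I : finType) (e : I -> I -> A) :
  idem_fun e -> idem_fun (amplify e).
Proof. by move=> ee; exact: amplifyM. Qed.

Lemma amplify_mvn (I J : finType) (e : I -> I -> A) (f : J -> J -> A) :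
  mvn_fun e f -> mvn_fun (amplify e) (amplify f).
Proof.
by move=> [u [v [uv vu]]]; exists (amplify u), (amplify v); split; exact: amplifyM.
Qed.

(** Applying a multiplicative map to the entries of matrices preserves
idempotents, their equivalence and direct sums, even if it is not unital. *)
Lemma K0_amplify : exists h : idem_classes A -> idem_classes B,
  {morph h : x y / x + y} /\
  forall (I : finType) (e : I -> I -> A) (ee : idem_fun e),
    h (cls ee) = cls (amplify_idem ee).
Proof.
have /choice[h hP] : forall c : idem_classes A, exists d : idem_classes B,
    forall (I : finType) (e : I -> I -> A) (ee : idem_fun e), c = cls ee ->
    d = cls (amplify_idem ee).
  move=> c; have [n [e [ee ->]]] := cls_surj c.
  exists (cls (amplify_idem ee)) => I f ff /clsP ef.
  exact/clsP/amplify_mvn.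
have hE (I : finType) (e : I -> I -> A) (ee : idem_fun e) :
  h (cls ee) = cls (amplify_idem ee) by exact: hP.
exists h; split=> // c d.
have [n [e [ee ->]]] := cls_surj c.
have [m [f [ff ->]]] := cls_surj d.
rewrite clsD !hE clsD; apply/clsP.
pose s (x : 'I_n * K + 'I_m * K) : ('I_n + 'I_m) * K :=
  match x with inl p => (inl p.1, p.2) | inr p => (inr p.1, p.2) end.
have sb : bijective s.
  exists (fun p => match p.1 with inl i => inl (i, p.2)
                                | inr i => inr (i, p.2) end).
    by case=> -[].
  by case=> -[].
have := mvn_fun_reindex (amplify_idem (idem_fun_sum ee ff)) sb.
suff -> : (fun a b => amplify (block_fun e f) (s a) (s b)) =
   block_fun (amplify e) (amplify f) by [].
apply/funext => -[] [i k]; apply/funext => -[] [j l] //=;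
  by rewrite /amplify /= matrix_morphism0.
Qed.

End Amplification.

(** If psi o phi is the amplification a |-> V a U by a column V and a row U with
U V = 1, then the idempotent e is equivalent to its image V e U, through e U and
V e. *)
Lemma amplify_inner (A B : pzRingType) (K L : finType) (phi : K -> K -> A -> B)
    (psi : L -> L -> B -> A) (U V : K -> L -> A) :
  \sum_k \sum_l U k l * V k l = 1 ->
  (forall k k' l l' a, psi l l' (phi k k' a) = V k l * a * U k' l') ->
  forall (I : finType) (e : I -> I -> A), idem_fun e ->
  mvn_fun e (amplify psi (amplify phi e)).
Proof.
move=> UV1 pp I e ee.
exists (fun i p => e i p.1.1 * U p.1.2 p.2).
exists (fun p j => V p.1.2 p.2 * e p.1.1 j).
split=> [i j|[[i k] l] [[i' k'] l']] /=; last first.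
  rewrite /amplify /= pp -ee mulr_sumr mulr_suml.
  by apply: eq_bigr => j _; rewrite !mulrA.
rewrite -ee.
transitivity (\sum_j0 \sum_k \sum_l e i j0 * (U k l * V k l) * e j0 j).
  rewrite [RHS]pair_bigA [RHS]pair_bigA /=.
  by apply: eq_bigr => p _; rewrite !mulrA.
apply: eq_bigr => j0 _; rewrite -[in RHS](mulr1 (e i j0)) -UV1.
rewrite mulr_sumr mulr_suml; apply: eq_bigr => k _.
by rewrite mulr_sumr mulr_suml.
Qed.

(** Two multiplicative maps into matrices whose composites are inner in the above
sense induce inverse isomorphisms on K_0. *)
Lemma K0_morita (A B : pzRingType) (K L : finType) (phi : K -> K -> A -> B)
    (psi : L -> L -> B -> A) (U V : K -> L -> A) (U' V' : L -> K -> B) :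
  matrix_morphism phi -> matrix_morphism psi ->
  \sum_k \sum_l U k l * V k l = 1 ->
  (forall k k' l l' a, psi l l' (phi k k' a) = V k l * a * U k' l') ->
  \sum_l \sum_k U' l k * V' l k = 1 ->
  (forall l l' k k' b, phi k k' (psi l l' b) = V' l k * b * U' l' k') ->
  isomorphic_groups (K0 A) (K0 B).
Proof.
move=> phiP psiP UV pp UV' pp'.
have [h [hD hE]] := K0_amplify phiP.
have [h' [_ h'E]] := K0_amplify psiP.
apply: (groth_functor hD); exists h'.
  move=> c; have [n [e [ee ->]]] := cls_surj c.
  rewrite hE h'E; apply/esym/clsP; exact: amplify_inner UV pp _ _ ee.
move=> c; have [n [e [ee ->]]] := cls_surj c.
rewrite h'E hE; apply/esym/clsP; exact: amplify_inner UV' pp' _ _ ee.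
Qed.

Section UnitClass.
Variable A : pzRingType.

Definition diag_fun n (q : A) : 'I_n -> 'I_n -> A := fun i j => q *+ (i == j).

Lemma diag_idem n (q : A) : q * q = q -> idem_fun (@diag_fun n q).
Proof.
move=> qq i k; rewrite (bigD1 i) //= big1 => [|j ji].
  by rewrite /diag_fun eqxx mulr1n addr0 mulrnAr qq.
by rewrite /diag_fun eq_sym (negbTE ji) mul0r.
Qed.

Definition idem_class (q : A) (qq : q * q = q) : idem_classes A :=
  cls (@diag_idem 1 q qq).

(** The diagonal matrix with n entries q is the n-fold direct sum of q. *)
Lemma cls_diag n (q : A) (qq : q * q = q) :
  cls (@diag_idem n q qq) = idem_class qq *+ n.
Proof.
elim: n => [|n ih].
  rewrite mulr0n -(cls0 A); apply/clsP.
  exists (fun (i : 'I_0) (v : void) => 0), (fun (v : void) (i : 'I_0) => 0).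
  by split => -[].
rewrite mulrS -ih clsD; apply/clsP.
pose s (x : 'I_1 + 'I_n) : 'I_n.+1 :=
  match x with inl _ => ord0 | inr i => lift ord0 i end.
have sb : bijective s.
  exists (fun i => if unlift ord0 i is Some j then inr j else inl ord0).
    by case=> i /=; rewrite ?unlift_none ?liftK // (ord1 i).
  by move=> i /=; case: unliftP => [j ->|->].
suff <- : (fun a b => diag_fun q (s a) (s b)) = block_fun (@diag_fun 1 q) (@diag_fun n q).
  exact: (mvn_fun_reindex (diag_idem qq) sb).
apply/funext => -[i|i]; apply/funext => -[j|j]; rewrite /diag_fun //=.
by rewrite !ord1.
Qed.

Definition K0_class (c : idem_classes A) : K0 A := \pi_(K0 A) (c, 0).

(** Vanishing in the Grothendieck group means vanishing up to a summand. *)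
Lemma K0_class_eq0 c : K0_class c = 0 -> exists z, c + z = z.
Proof. by move=> /grothP[z /=]; rewrite !addr0 add0r; exists z. Qed.

Lemma K0_classD c d : K0_class (c + d) = K0_class c + K0_class d.
Proof.
by rewrite [RHS](groth_addE (c, 0) (d, 0)) /= addr0.
Qed.

Lemma K0_classMn c n : K0_class (c *+ n) = K0_class c *+ n.
Proof. by elim: n => // n ih; rewrite !mulrS K0_classD ih. Qed.

Lemma K0_diff (a : K0 A) : exists c d, a = K0_class c - K0_class d.
Proof.
elim/quotW: a => -[c d]; exists c, d.
rewrite -[RHS]/(groth_add (K0_class c) (groth_opp (K0_class d))).
by rewrite groth_oppE groth_addE /= addr0 add0r.
Qed.

Definition K0_unit : K0 A := K0_class (idem_class (mulr1 1)).

(** If n[1] = 0 then 1_n + e is equivalent to e for some idempotent matrix e, say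
1_n + e = u v and e = v u.  Adding up the diagonal entries of u v and of v u gives
two elements that differ by n, and also by a sum of commutators. *)
Lemma K0_unit_commutators n : K0_unit *+ n = 0 ->
  exists s : seq (A * A), \sum_(x <- s) (x.1 * x.2 - x.2 * x.1) = n%:R.
Proof.
rewrite -K0_classMn -cls_diag => /K0_class_eq0[z].
have [m [e [ee ->]]] := cls_surj z.
rewrite clsD => /clsP[u [v [uv vu]]].
exists [seq (u p.1 p.2, v p.2 p.1) | p <- enum {: ('I_n + 'I_m) * 'I_m}].
rewrite big_map big_enum /= -(pair_bigA _ (fun i j => u i j * v j i - v j i * u i j)).
under eq_bigr => i _ do rewrite sumrB uv.
rewrite sumrB exchange_big /=.
under [X in _ - X]eq_bigr => i _ do rewrite vu.
rewrite big_sumType /= addrK.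
under eq_bigr => i _ do rewrite /diag_fun eqxx mulr1n.
by rewrite sumr_const card_ord.
Qed.

(** The hypotheses say that 1 is equivalent to the diagonal matrix with n entries
q, through the row u and the column v. *)
Lemma K0_unit_div n (q : A) (u v : 'I_n -> A) : q * q = q ->
  \sum_i u i * v i = 1 -> (forall i j, v i * u j = q *+ (i == j)) ->
  exists b, K0_unit = b *+ n.
Proof.
move=> qq uv vu; exists (K0_class (idem_class qq)).
rewrite -K0_classMn -cls_diag; congr K0_class; apply/clsP.
exists (fun _ i => u i), (fun i _ => v i); split=> [i k|i j].
  by rewrite uv /diag_fun !ord1.
by rewrite big_ord1 vu.
Qed.

End UnitClass.

(** Divisibility by arbitrarily large integers, not by all integers: in the
application the divisors are the orders of the finite subgroups of a chain. *)
Definition infinitely_divisible (U : zmodType) (a : U) : Prop :=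
  forall n, exists2 m, (n <= m)%N & exists b, a = b *+ m.

Lemma isomorphic_groups_sym (U V : zmodType) :
  isomorphic_groups U V -> isomorphic_groups V U.
Proof.
move=> [f [g fK gK]].
have gB : zmod_morphism g.
  by move=> x y; apply: (can_inj fK); rewrite raddfB !gK.
pose gm := GRing.isZmodMorphism.Build V U g gB.
by exists (HB.pack_for {additive V -> U} g gm); exists f.
Qed.

Lemma infinitely_divisible_iso (U V : zmodType) : isomorphic_groups U V ->
  (forall b : V, infinitely_divisible b -> b = 0) ->
  forall a : U, infinitely_divisible a -> a = 0.
Proof.
move=> [f fb] V0 a adiv; apply: (bij_inj fb); rewrite raddf0; apply: V0 => n.
have [m nm [b ->]] := adiv n; exists m => //.
by exists (f b); rewrite raddfMn.
Qed.

Section FieldK0.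
Variable F : numFieldType.

(** An idempotent matrix E of rank r is equivalent to the identity of size r: in
a rank factorisation E = C P one has P C = 1, because C P C P = C P while C can be
cancelled on the left and P on the right. *)
Lemma K0_field_generated (a : K0 F) : exists z : int, a = K0_unit F *~ z.
Proof.
suff clsE (c : idem_classes F) : exists r, c = idem_class (mulr1 (1 : F)) *+ r.
  have [c [d ->]] := K0_diff a.
  have [r ->] := clsE c; have [s ->] := clsE d.
  by exists (r%:Z - s%:Z); rewrite !K0_classMn mulrzBr.
have [n [e [ee ->]]] := cls_surj c.
pose E := \matrix_(i, j) e i j.
have EE : E *m E = E.
  apply/matrixP => i k; rewrite !mxE -ee.
  by apply: eq_bigr => j _; rewrite !mxE.
exists (\rank E); rewrite -cls_diag; apply/clsP.
exists (fun i j => col_base E i j), (fun i j => row_base E i j).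
split=> [i k|i k].
  by have /matrixP/(_ i k) := mulmx_base E; rewrite !mxE.
have RC : row_base E *m col_base E = 1%:M.
  apply: (row_free_inj (row_base_free E)).
  apply: (row_full_inj (col_base_full E)).
  have CR := mulmx_base E; move: (row_base E) (col_base E) CR => P C CR.
  by rewrite mul1mx !mulmxA CR -mulmxA CR EE.
by have /matrixP/(_ i k) := RC; rewrite !mxE.
Qed.

(** Commutators vanish in a field, and n is nonzero there for n > 0. *)
Lemma K0_unit_torsion_free n : K0_unit F *+ n = 0 -> n = 0%N.
Proof.
move=> /K0_unit_commutators[s]; rewrite big1 => [/eqP|x _].
  by rewrite eq_sym pnatr_eq0 => /eqP.
by rewrite mulrC subrr.
Qed.

(** K_0 is infinite cyclic, and a nonzero integer z has no divisor larger than
|z|. *)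
Lemma K0_field_not_divisible (a : K0 F) : infinitely_divisible a -> a = 0.
Proof.
have [z ->] := K0_field_generated a => zdiv.
have [m zm [b]] := zdiv `|z|.+1%N; have [w ->] := K0_field_generated b.
rewrite pmulrn -mulrzA => /eqP; rewrite -subr_eq0 -mulrzBr => /eqP k0.
have : (z - w * m)%R = 0.
  apply/eqP; rewrite -absz_eq0; apply/eqP; apply: K0_unit_torsion_free.
  move: k0; case: (z - w * m) => k //=.
  rewrite NegzE mulrNz => /eqP; rewrite oppr_eq0 => /eqP.
  exact.
move=> /eqP; rewrite subr_eq0 => /eqP zE.
have [w0|w0] := eqVneq w 0; first by rewrite zE w0 mul0r mulr0z.
have := zm; rewrite zE abszM /= ltnNge leq_pmull //.
by rewrite absz_gt0.
Qed.

End FieldK0.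

Local Close Scope quotient_scope.

(** * Operators induced by partial bijections, and coarse invariance *)

(** Carrying the inverse along makes every partial bijection act on functions
in both directions without any choice. *)
Record partial_bij (X Y : Type) := PartialBij {
  fwd : X -> option Y;
  bwd : Y -> option X;
  fwdP : forall x y, fwd x = Some y <-> bwd y = Some x }.

Definition partial_inv X Y (s : partial_bij X Y) : partial_bij Y X :=
  @PartialBij Y X (bwd s) (fwd s) (fun y x => iff_sym (fwdP s x y)).

Lemma fwd_inj X Y (s : partial_bij X Y) x x' y :
  fwd s x = Some y -> fwd s x' = Some y -> x = x'.
Proof. by move=> /fwdP xy /fwdP; rewrite xy => -[]. Qed.

Section Translation.
Variables (R : realType) (p : R) (p1 : 1 <= p).

Section One.
Variables (X Y : choiceType) (s : partial_bij X Y).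

(** Pushing f forward along s, and extending by zero; in particular delta_x goes
to delta_(s x), or to 0 if s is undefined at x. *)
Definition translate_fun (f : X -> R[i]^o) : Y -> R[i]^o :=
  fun y => oapp f 0 (bwd s y).

Lemma lp_sum_translate f : (lp_sum p (translate_fun f) <= lp_sum p f)%E.
Proof.
have p0 : 0 < p by exact: lt_le_trans p1.
rewrite lp_sum.unlock /translate_fun.
pose a (o : option X) : \bar R := (normc (oapp f 0 o) `^ p)%:E.
have a0 o : (0 <= a o)%E by rewrite lee_fin powR_ge0.
have -> : \esum_(x in [set: X]) (normc (f x) `^ p)%:E =
    \esum_(o in [set Some x | x in [set: X]]) a o.
  rewrite (@reindex_esum _ X _ [set: X] [set Some x | x in [set: X]] Some) //.
pose D := [set y | bwd s y != None].
have -> : \esum_(y in [set: Y]) (normc (oapp f 0 (bwd s y)) `^ p)%:E =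
    \esum_(y in D) a (bwd s y).
  rewrite [RHS]esum_mkcond; apply: eq_esum => y _.
  case: ifPn => //; rewrite notin_setE /D /= => /negP; rewrite negbK => /eqP ->.
  by rewrite -[oapp f 0 None]/(0 : R[i]) normc0 powR0 // gt_eqF.
rewrite -(@reindex_esum _ Y _ D (bwd s @` D) (bwd s)) //; last first.
  split=> [y Dy|y y' Dy _ yy'|o //]; first by exists y.
  move: (set_mem Dy); rewrite /D /=; case E: (bwd s y) => [x|//] _.
  by apply: (@fwd_inj _ _ (partial_inv s) _ _ x) => //=; rewrite -yy'.
rewrite esum_mkcond [leRHS]esum_mkcond; apply: le_esum => o _.
case: ifPn => [|_]; last by case: ifP.
rewrite inE => -[y Dy yo]; rewrite ifT // inE.
by move: Dy; rewrite /D /= yo; case: (o) => // x _; exists x.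
Qed.

Lemma translate_subproof (f : lp X p1) : translate_fun f \in @lp_pred R Y p p1.
Proof.
apply/asboolP; apply: le_lt_trans (lp_sum_translate f) _.
exact/asboolP/lp_funP.
Qed.

Definition translate (f : lp X p1) : lp Y p1 := Lp (translate_subproof f).

Lemma translate_linear : linear translate.
Proof.
move=> c f g; apply/val_inj/funext => y.
rewrite -[LHS]/(oapp (fun x => c * f x + g x) 0 (bwd s y)).
rewrite -[RHS]/(c * oapp f 0 (bwd s y) + oapp g 0 (bwd s y)).
by case: (bwd s y) => //=; rewrite mulr0 addr0.
Qed.

HB.instance Definition _ :=
  GRing.isLinear.Build R[i] (lp X p1) (lp Y p1) *:%R translate translate_linear.

Lemma translate_norm f : `|translate f| <= `|f|.
Proof.
rewrite !lp_normrE (lp_norm_le _ (lp_norm_ge0 f)) lp_norm_powR.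
exact: lp_sum_translate.
Qed.

Lemma translate_delta x :
  translate (delta p1 x) = oapp (delta p1) 0 (fwd s x).
Proof.
apply/val_inj/funext => y; rewrite -[LHS]/(oapp (delta p1 x) 0 (bwd s y)).
case E: (fwd s x) => [z|] /=.
  rewrite -[RHS]/((y == z)%:R); case E': (bwd s y) => [x'|] /=.
    move/fwdP: E' => E'; rewrite -[LHS]/((x' == x)%:R).
    suff -> : (x' == x) = (y == z) by [].
    apply/eqP/eqP => [xx|yz]; first by move: E E'; rewrite xx => -> [].
    by apply: fwd_inj E' _; rewrite E yz.
  have [yz|//] := eqVneq y z.
  by move/fwdP: E; rewrite -yz E'.
case E': (bwd s y) => [x'|] //=.
rewrite -[LHS]/((x' == x)%:R); have [xx|//] := eqVneq x' x.
by move/fwdP: E'; rewrite xx E.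
Qed.

End One.

(** If the domains of the s_k partition X, then the identity of l^p(X) is the sum
of the V_k^-1 V_k, V_k being translation along s_k. *)
Lemma translate_cover (X Y : choiceType) (K : finType) (s : K -> partial_bij X Y)
    (c : X -> K) : (forall x k, isSome (fwd (s k) x) = (k == c x)) ->
  forall f : lp X p1, \sum_k translate (partial_inv (s k)) (translate (s k) f) = f.
Proof.
move=> sc f; apply/val_inj/funext => x.
have -> : val (\sum_k translate (partial_inv (s k)) (translate (s k) f)) x =
    \sum_k (translate (partial_inv (s k)) (translate (s k) f)) x.
  by apply: (big_morph (fun g : lp X p1 => g x)).
have tE k : translate (partial_inv (s k)) (translate (s k) f) x =
    oapp (translate (s k) f) 0 (fwd (s k) x) by [].
rewrite (@big_only1 _ _ _ _ (c x)) // => [|k kc _]; rewrite tE.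
  have := sc x (c x); rewrite eqxx; case E: (fwd _ x) => [y|//] _.
  by move/fwdP: E => E; rewrite -[LHS]/(oapp f 0 (bwd (s (c x)) y)) E.
by have := sc x k; rewrite (negbTE kc); case: fwd.
Qed.

Section Two.
Variables (X Y : choiceType).
Local Notation bopX := (bop X p1).
Local Notation bopY := (bop Y p1).

Lemma compress_subproof (s t : partial_bij X Y) (T : bopX) :
  (fun f => translate s (T (translate (partial_inv t) f))) \in @bounded_linear R Y p p1.
Proof.
apply/asboolP; split=> [c f g|]; first by rewrite !linearP.
exists (opnorm T) => f; apply: le_trans (translate_norm _ _) _.
apply: le_trans (opnormP _ _) _.
by rewrite ler_wpM2l ?opnorm_ge0 ?translate_norm.
Qed.

(** The matrix entry V_s T V_t^-1 of the map induced by a family of partial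
bijections. *)
Definition compress (s t : partial_bij X Y) (T : bopX) : bopY :=
  Bop (compress_subproof s t T).

Lemma compress_norm s t T : `|compress s t T| <= `|T|.
Proof.
apply: opnorm_le => [|f]; first exact: opnorm_ge0.
apply: le_trans (translate_norm _ _) _; apply: le_trans (opnormP _ _) _.
by rewrite ler_wpM2l ?opnorm_ge0 ?translate_norm.
Qed.

Lemma compressB s t : {morph compress s t : S T / S - T}.
Proof.
by move=> S T; apply: bop_ext => f; exact: (linearB (translate s)).
Qed.

Lemma compressD s t : {morph compress s t : S T / S + T}.
Proof.
by move=> S T; apply: bop_ext => f; exact: (linearD (translate s)).
Qed.

Lemma opcoef_compress s t T a b : opcoef (compress s t T) a b != 0 ->
  exists x y, [/\ fwd s x = Some a, fwd t y = Some b & opcoef T x y != 0].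
Proof.
rewrite -[opcoef _ _ _]/(oapp (T (translate (partial_inv t) (delta p1 b))) 0 (bwd s a)).
rewrite translate_delta -[fwd (partial_inv t) b]/(bwd t b).
case E: (bwd t b) => [y|]; last first.
  by rewrite linear0; case: bwd => [x|]; rewrite eqxx.
case E': (bwd s a) => [x|]; last by rewrite eqxx.
by exists x, y; split => //; apply/fwdP.
Qed.

Lemma roundtrip_subproof (s : partial_bij Y X) (t : partial_bij X Y) :
  (fun f => translate s (translate t f)) \in @bounded_linear R X p p1.
Proof.
apply/asboolP; split=> [c f g|]; first by rewrite !linearP.
exists 1 => f; rewrite mul1r; apply: le_trans (translate_norm _ _) _.
exact: translate_norm.
Qed.

(** Two translations composed into an operator on one space; this is how elements
of the Roe algebra of X are made of partial bijections through Y. *)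
Definition roundtrip (s : partial_bij Y X) (t : partial_bij X Y) : bopX :=
  Bop (roundtrip_subproof s t).

Lemma opcoef_roundtrip s t a b : opcoef (roundtrip s t) a b != 0 ->
  exists2 y, fwd t b = Some y & fwd s y = Some a.
Proof.
rewrite -[opcoef _ _ _]/(oapp (translate t (delta p1 b)) 0 (bwd s a)).
rewrite translate_delta; case E: (bwd s a) => [y|]; last by rewrite eqxx.
move/fwdP: E => E; case E': (fwd t b) => [y'|]; last by rewrite eqxx.
rewrite -[X in X != 0]/((y == y')%:R); have [<-|] := eqVneq y y'.
  by exists y.
by rewrite eqxx.
Qed.

End Two.
End Translation.

Section RoeElements.
Variables (R : realType) (p : R) (p1 : 1 <= p) (X : metricType R).

Lemma finite_propagation_roe (T : bop X p1) :
  finite_propagation T -> T \in @roe_pred R X p p1.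
Proof.
by move=> fT; apply/asboolP/closure_bopP => e e0; exists T; rewrite ?subrr ?normr0.
Qed.

Lemma roe_approx (T : uniform_roe X p1) e : 0 < e ->
  exists2 S : bop X p1, finite_propagation S & `|(T : bop X p1) - S| < e.
Proof. by move=> e0; have /asboolP/closure_bopP := uniform_roe_valP T; exact. Qed.

Lemma roe_sumE (I : finType) (F : I -> uniform_roe X p1) f :
  (\sum_i F i : uniform_roe X p1) f = \sum_i F i f.
Proof. exact: (big_morph (fun T : uniform_roe X p1 => T f)). Qed.

Lemma roe_ext (S T : uniform_roe X p1) : (forall f, S f = T f) -> S = T.
Proof. by move=> ST; apply/val_inj/bop_ext. Qed.

End RoeElements.

Section CoarseMorita.
Variables (R : realType) (p : R) (p1 : 1 <= p).

(** When c separates the points of each fibre of f, restricting f to the colour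
classes of c cuts it into partial bijections, its sheets. *)
Section Coloured.
Variables (X Y : metricType R) (K : finType) (f : X -> Y) (c : X -> K).
Hypothesis fc : forall x x', f x = f x' -> c x = c x' -> x = x'.

Definition sheet_fwd k x : option Y := if c x == k then Some (f x) else None.

Definition sheet_bwd k y : option X :=
  if pselect (exists x, f x = y /\ c x = k) is left e
  then Some (proj1_sig (cid e)) else None.

Lemma sheetP k x y : sheet_fwd k x = Some y <-> sheet_bwd k y = Some x.
Proof.
rewrite /sheet_fwd /sheet_bwd; split.
  case: eqP => // ck [fx]; case: pselect => [e|[]]; last by exists x.
  by case: (cid e) => x' /= [fx' cx']; congr Some; apply: fc; rewrite ?cx' ?fx'.
case: pselect => // e; case: (cid e) => x' /= [fx' cx'] [<-].
by rewrite cx' eqxx fx'.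
Qed.

Definition sheet k : partial_bij X Y := PartialBij (sheetP k).

Lemma sheet_colour x k : isSome (fwd (sheet k) x) = (k == c x).
Proof. by rewrite /= /sheet_fwd eq_sym; case: eqP. Qed.

Lemma fwd_sheet k x y : fwd (sheet k) x = Some y -> f x = y.
Proof. by rewrite /= /sheet_fwd; case: eqP => // _ []. Qed.

Hypothesis f_exp : uniformly_expansive f.

(** A nonzero entry of the compressed operator at (f x, f y) comes from a nonzero
entry of T at (x, y), and f is uniformly expansive. *)
Lemma sheet_finite_propagation k l (T : bop X p1) : finite_propagation T ->
  finite_propagation (compress (sheet k) (sheet l) T).
Proof.
move=> /finite_propagationP[r rT]; apply/finite_propagationP.
have r1 : 0 < Num.max r 1 by rewrite lt_max ltr01 orbT.
have [t t0 rt] := f_exp r1.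
exists t => a b /opcoef_compress[x [y [/fwd_sheet <- /fwd_sheet <- Txy]]].
by apply: rt; rewrite le_max rT.
Qed.

Lemma sheet_roe k l (T : uniform_roe X p1) :
  compress (sheet k) (sheet l) (T : bop X p1) \in @roe_pred R Y p p1.
Proof.
apply/asboolP/closure_bopP => e e0; have [S fS TS] := roe_approx T e0.
exists (compress (sheet k) (sheet l) S); first exact: sheet_finite_propagation.
by rewrite -compressB; apply: le_lt_trans (compress_norm _ _ _) _.
Qed.

Definition transport k l (T : uniform_roe X p1) : uniform_roe Y p1 :=
  UniformRoe (sheet_roe k l T).

Lemma transport_morphism : matrix_morphism transport.
Proof.
split=> [k l S T|k m S T]; apply: roe_ext => g.
  by rewrite -[LHS]/(compress (sheet k) (sheet l) ((S : bop X p1) + (T : bop X p1)) g)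
    compressD.
rewrite roe_sumE.
transitivity (translate (sheet k) (S (\sum_l translate (partial_inv (sheet l))
  (translate (sheet l) (T (translate (partial_inv (sheet m)) g)))))).
  by rewrite !linear_sum.
by rewrite (translate_cover sheet_colour).
Qed.

End Coloured.

Lemma roundtrip_close (X Y : metricType R) (f : X -> Y)
    (g : Y -> X) (s : partial_bij Y X) (t : partial_bij X Y) :
  close_maps (g \o f) id ->
  (forall x y, fwd t x = Some y -> f x = y) ->
  (forall y x, fwd s y = Some x -> g y = x) ->
  roundtrip p1 s t \in @roe_pred R X p p1 /\
  roundtrip p1 (partial_inv t) (partial_inv s) \in @roe_pred R X p p1.
Proof.
move=> [r r0 gfr] tf sg; split; apply: finite_propagation_roe;
  apply/finite_propagationP; exists r => a b /opcoef_roundtrip[y].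
  by move=> /tf <- /sg <-; exact: gfr.
move=> /fwdP /sg <- /fwdP /tf <-.
by rewrite metric_sym; exact: gfr.
Qed.

(** The composite of transport along f and transport along g is conjugation by
the operators that g o f induces on X; they have finite propagation because g o f
is close to the identity. *)
Lemma sheets_inner (X Y : metricType R) (K L : finType)
    (f : X -> Y) (g : Y -> X) (c : X -> K) (d : Y -> L)
    (fc : forall x x', f x = f x' -> c x = c x' -> x = x')
    (gd : forall y y', g y = g y' -> d y = d y' -> y = y')
    (fe : uniformly_expansive f) (ge : uniformly_expansive g) :
  close_maps (g \o f) id ->
  exists U V : K -> L -> uniform_roe X p1,
    \sum_k \sum_l U k l * V k l = 1 /\
    forall k k' l l' T,
      transport gd ge l l' (transport fc fe k k' T) = V k l * T * U k' l'.
Proof.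
move=> gf.
have rt k l := roundtrip_close gf (fwd_sheet (fc := fc) (k := k))
  (fwd_sheet (fc := gd) (k := l)).
exists (fun k l => UniformRoe (rt k l).2), (fun k l => UniformRoe (rt k l).1).
split=> [|k k' l l' T]; last exact: roe_ext.
apply: roe_ext => h; rewrite roe_sumE.
transitivity (\sum_k translate (partial_inv (sheet fc k)) (\sum_l
  translate (partial_inv (sheet gd l)) (translate (sheet gd l)
    (translate (sheet fc k) h)))).
  by apply: eq_bigr => k _; rewrite roe_sumE linear_sum.
under eq_bigr => k _ do rewrite (translate_cover (sheet_colour gd)).
by rewrite (translate_cover (sheet_colour fc)).
Qed.

(** The coloured maps f and g give multiplicative maps into matrices over the
other Roe algebra, with inner composites. *)
Lemma coarse_K0 (X Y : metricType R) (K L : finType)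
    (f : X -> Y) (g : Y -> X) (c : X -> K) (d : Y -> L) :
  uniformly_expansive f -> uniformly_expansive g ->
  close_maps (f \o g) id -> close_maps (g \o f) id ->
  (forall x x', f x = f x' -> c x = c x' -> x = x') ->
  (forall y y', g y = g y' -> d y = d y' -> y = y') ->
  isomorphic_groups (K0 (uniform_roe X p1)) (K0 (uniform_roe Y p1)).
Proof.
move=> fe ge fg gf fc gd.
have [U [V [UV pp]]] := sheets_inner fc gd fe ge gf.
have [U' [V' [UV' pp']]] := sheets_inner gd fc ge fe fg.
exact: (K0_morita (transport_morphism fc fe) (transport_morphism gd ge) UV pp UV' pp').
Qed.

End CoarseMorita.

(** * Finite spaces and spaces with nested blocks *)

Section Coefficients.
Variables (R : realType) (p : R) (p1 : 1 <= p) (X : choiceType).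
Local Notation bopX := (bop X p1).

Lemma opcoef_norm (T : bopX) x y : normc (opcoef T x y) <= `|T|.
Proof.
apply: le_trans (lp_norm_ge _ _) _; apply: le_trans (opnormP _ _) _.
rewrite -[leRHS]mulr1 ler_wpM2l ?opnorm_ge0 // lp_normrE lp_norm_le //.
rewrite powR1 lp_sum.unlock.
have -> : \esum_(x in [set: X]) (normc (delta p1 y x) `^ p)%:E =
    \esum_(x in [set y]) 1%E :> \bar R; last by rewrite esum_set1.
rewrite (esum_mkcond [set y]); apply: eq_esum => z _.
rewrite -[delta p1 y z]/((z == y)%:R : R[i]) in_set1.
case: eqP => _; first by rewrite normc1 powR1.
by rewrite normc0 powR0 // gt_eqF // (lt_le_trans ltr01).
Qed.

(** The support condition makes T delta_z a finite combination of deltas, so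
that no convergence is involved. *)
Lemma opcoefM (S T : bopX) (s : seq X) x z : uniq s ->
  (forall y, opcoef T y z != 0 -> y \in s) ->
  opcoef (S * T) x z = \sum_(y <- s) opcoef S x y * opcoef T y z.
Proof.
move=> us sT.
have TE : T (delta p1 z) = \sum_(y <- s) opcoef T y z *: delta p1 y.
  apply/val_inj/funext => y; rewrite [RHS]lp_fun_sum //.
  by case: ifPn => // ys; apply/eqP; apply: contraNT ys; exact: sT.
rewrite -[LHS]/(S (T (delta p1 z)) x) TE linear_sum.
rewrite (big_morph (fun g : lp X p1 => g x) (id1 := 0) (op1 := +%R)) //.
apply: eq_bigr => y _; rewrite linearZ -[LHS]/(opcoef T y z * opcoef S x y).
by rewrite mulrC.
Qed.

Lemma rank_one_subproof (x y : X) (c : R[i]) :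
  (fun f : lp X p1 => (c * f y) *: delta p1 x) \in @bounded_linear R X p p1.
Proof.
apply/asboolP; split=> [a f g|].
  by rewrite scalerA -scalerDl; congr (_ *: _); rewrite mulrDr !mulrA [c * a]mulrC.
exists (normc c * `|delta p1 x|) => f.
rewrite normr_lpZ normcM -!mulrA ler_wpM2l ?normc_ge0 // mulrC.
by rewrite ler_wpM2l ?normr_ge0 // lp_norm_ge.
Qed.

Definition rank_one x y c : bopX := Bop (rank_one_subproof x y c).

End Coefficients.

Section FiniteSpace.
Variables (R : realType) (p : R) (p1 : 1 <= p) (X : metricType R).
Variables (n : nat) (e : 'I_n -> X) (x0 : X).
Hypothesis e_bij : bijective e.

(** A finite space is bounded. *)
Lemma finite_space_roe (T : bop X p1) : T \in @roe_pred R X p p1.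
Proof.
apply/finite_propagation_roe/finite_propagationP.
exists (\sum_i \sum_j mdist (e i) (e j)) => x y _.
have [g _ ge] := e_bij; rewrite -(ge x) -(ge y).
rewrite (bigD1 (g x)) //= (bigD1 (g y)) //= -addrA lerDl addr_ge0 //.
  by apply: sumr_ge0 => j _; exact: mdist_ge0.
by apply: sumr_ge0 => i _; apply: sumr_ge0 => j _; exact: mdist_ge0.
Qed.

Definition roe_unit x y c : uniform_roe X p1 :=
  UniformRoe (finite_space_roe (rank_one p1 x y c)).

Lemma opcoef_morphism : matrix_morphism
  (fun i j (T : uniform_roe X p1) => opcoef (T : bop X p1) (e i) (e j)).
Proof.
split=> // i k S T.
rewrite (@opcoefM _ _ _ _ (S : bop X p1) (T : bop X p1) (map e (enum 'I_n))).
- by rewrite big_map big_enum.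
- by rewrite map_inj_uniq ?enum_uniq //; exact: bij_inj.
- move=> y _; have [g _ ge] := e_bij.
  by rewrite -(ge y) map_f // mem_enum.
Qed.

Lemma roe_unit_morphism :
  matrix_morphism (fun (_ _ : 'I_1) c => roe_unit x0 x0 c).
Proof.
split=> [_ _ a b|_ _ a b]; apply: roe_ext => f.
  by rewrite -[RHS]/((a * f x0) *: _ + (b * f x0) *: _) -scalerDl -mulrDl.
rewrite big_ord1 -[LHS]/((a * ((b * f x0) * (x0 == x0)%:R)) *: delta p1 x0).
by rewrite eqxx mulr1 mulrA.
Qed.

(** The matrix coefficients in one direction, and c |-> c E_00 in the other, with
E_00 the matrix unit at a base point, are mutually inverse up to conjugation by
matrix units. *)
Lemma finite_space_K0 : isomorphic_groups (K0 (uniform_roe X p1)) (K0 R[i]).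
Proof.
apply: (@K0_morita _ _ _ _ _ _
  (fun i (_ : 'I_1) => roe_unit (e i) x0 1) (fun i _ => roe_unit x0 (e i) 1)
  (fun _ i => (e i == x0)%:R) (fun _ i => (e i == x0)%:R)
  opcoef_morphism roe_unit_morphism).
- apply: roe_ext => f; rewrite roe_sumE.
  under eq_bigr => i _ do rewrite big_ord1.
  apply/val_inj/funext => x; have [g eg ge] := e_bij.
  rewrite -[RHS](_ : (\sum_i f (e i) *: delta p1 (e i) : lp X p1) x = _).
    congr (lp_fun _ x); apply: eq_bigr => i _.
    rewrite -[LHS]/((1 * ((1 * f (e i)) * (x0 == x0)%:R)) *: delta p1 (e i)).
    by rewrite eqxx mulr1 !mul1r.
  have := lp_fun_sum f x (s := map e (enum 'I_n)).
  rewrite big_map big_enum => ->.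
    by rewrite -{1}(ge x) map_f // mem_enum.
  by rewrite map_inj_uniq ?enum_uniq //; exact: bij_inj.
- move=> i j _ _ T; apply: roe_ext => f.
  rewrite -[RHS]/((1 * (T ((1 * f x0) *: delta p1 (e j))) (e i)) *: delta p1 x0).
  rewrite linearZ -[LHS]/((opcoef (T : bop X p1) (e i) (e j) * f x0) *: delta p1 x0).
  congr (_ *: _); rewrite !mul1r mulrC //.
- rewrite big_ord1; have [g eg ge] := e_bij.
  rewrite (@big_only1 _ _ _ _ (g x0)) //; first by rewrite ge eqxx mulr1.
  move=> i ix _; rewrite (_ : e i == x0 = false) ?mul0r //.
  by apply/eqP => ex; move: ix; rewrite -ex eg eqxx.
- move=> _ _ i j c.
  rewrite -[LHS]/((c * (x0 == e j)%:R) * (e i == x0)%:R).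
  by rewrite [x0 == _]eq_sym mulrC mulrA.
Qed.

End FiniteSpace.

Lemma Some_eq_sym (X : Type) (x y : X) : Some x = Some y <-> Some y = Some x.
Proof. by split. Qed.

Definition partial_bij_id (X : Type) : partial_bij X X := PartialBij (@Some_eq_sym X).
Arguments partial_bij_id {X}.

Section Blocks.
Variables (R : realType) (X : metricType R) (e : nat -> X) (N : nat -> nat).

(** The metric of X is, up to coarse equivalence, that of the natural numbers with
the blocks of consecutive integers of length N_k as bounded sets: the model for a
group with a chain of finite subgroups of orders N_k. *)
Definition block_enumeration : Prop :=
  [/\ bijective e, divisor_chain N,
      forall r, exists k, forall i j,
        mdist (e i) (e j) <= r -> (i %/ N k = j %/ N k)%N &
      forall k, exists r, forall i j,
        (i %/ N k = j %/ N k)%N -> mdist (e i) (e j) <= r].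

Hypothesis eN : block_enumeration.

Lemma block_gt0 k : (0 < N k)%N.
Proof. by have [_ NP _ _] := eN; exact: divisor_chain_gt0. Qed.

Lemma block_refine k l i j : (k <= l)%N ->
  (i %/ N k = j %/ N k)%N -> (i %/ N l = j %/ N l)%N.
Proof.
have [_ NP _ _] := eN => kl ij; have /dvdnP[b ->] := divisor_chain_dvd NP kl.
by rewrite mulnC !divnMA ij.
Qed.

Variables (p : R) (p1 : 1 <= p).

(** The trace of the compression of T to the first N_k points.  It is not
normalised, hence the factors N_k in the estimates below. *)
Definition block_trace k (T : bop X p1) : R[i] :=
  \sum_(i < N k) opcoef T (e i) (e i).

Lemma block_traceD k : {morph block_trace k : S T / S + T}.
Proof. by move=> S T; rewrite -big_split. Qed.

Lemma block_traceN k : {morph block_trace k : T / - T}.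
Proof. by move=> T; rewrite -sumrN. Qed.

Lemma block_trace1 k : block_trace k 1 = (N k)%:R.
Proof.
rewrite /block_trace; under eq_bigr => i _.
  rewrite -[opcoef _ _ _]/((e i == e i)%:R : R[i]) eqxx; over.
by rewrite sumr_const card_ord.
Qed.

Lemma normc_sum (I : finType) (F : I -> R[i]) :
  normc (\sum_i F i) <= \sum_i normc (F i).
Proof.
elim/big_ind2: _ => // [|a b c d ab cd]; first by rewrite normc0.
by apply: le_trans (le_normcD _ _) _; exact: lerD.
Qed.

Lemma block_trace_norm k T : normc (block_trace k T) <= `|T| *+ N k.
Proof.
apply: le_trans (normc_sum _) _; rewrite -[X in _ *+ X]card_ord -sumr_const.
by apply: ler_sum => i _; exact: opcoef_norm.
Qed.

(** Operators that are block diagonal for the blocks of length N_k restrict to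
the first of these blocks, and the trace of matrices is symmetric. *)
Lemma block_trace_comm k (S T : bop X p1) :
  (forall i j, opcoef S (e i) (e j) != 0 -> (i %/ N k = j %/ N k)%N) ->
  (forall i j, opcoef T (e i) (e j) != 0 -> (i %/ N k = j %/ N k)%N) ->
  block_trace k (S * T) = block_trace k (T * S).
Proof.
have [eb _ _ _] := eN; have e_inj := bij_inj eb; have [g eg ge] := eb.
have mulE (S' T' : bop X p1) :
    (forall i j, opcoef T' (e i) (e j) != 0 -> (i %/ N k = j %/ N k)%N) ->
    block_trace k (S' * T') = \sum_(i < N k) \sum_(j < N k)
      opcoef S' (e i) (e j) * opcoef T' (e j) (e i).
  move=> T'k; apply: eq_bigr => i _.
  rewrite (@opcoefM _ _ _ _ S' T' [seq e j | j <- iota 0 (N k)]).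
  - rewrite big_map -(big_mkord xpredT (fun j => opcoef S' (e i) (e j) *
      opcoef T' (e j) (e i))).
    by rewrite /index_iota subn0.
  - by rewrite map_inj_uniq ?iota_uniq.
  - move=> y; rewrite -(ge y) => /T'k yi.
    apply/map_f; rewrite mem_iota add0n leq0n /=.
    by rewrite -[N k]mul1n -ltn_divLR ?block_gt0 // yi divn_small.
move=> Sk Tk; rewrite !mulE // exchange_big /=.
by apply: eq_bigr => i _; apply: eq_bigr => j _; rewrite mulrC.
Qed.

(** S and T are approximated by operators of finite propagation, which are block
diagonal from some level on, so that their commutator has trace zero; the error
is controlled by the operator norm. *)
Lemma roe_trace_comm (S T : uniform_roe X p1) (d : R) : 0 < d ->
  exists K, forall k, (K <= k)%N ->
    normc (block_trace k ((S * T - T * S) : uniform_roe X p1)) <= d *+ N k.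
Proof.
move=> d0; have d20 : 0 < d / 2 by rewrite divr_gt0.
have [_ _ mN _] := eN.
have approx (U : uniform_roe X p1) c : 0 < c -> exists2 V : bop X p1,
    `|(U : bop X p1) - V| < c &
    exists K, forall k, (K <= k)%N -> forall i j,
      opcoef V (e i) (e j) != 0 -> (i %/ N k = j %/ N k)%N.
  move=> c0; have [V /finite_propagationP[r rV] UV] := roe_approx U c0.
  exists V => //; have [K rK] := mN r; exists K => k Kk i j /rV /rK.
  exact: block_refine.
set s : bop X p1 := S; set t : bop X p1 := T.
have small (a b : R) : 0 <= a -> b < d / 4 / (a + 1) -> a * b <= d / 4.
  move=> a0; rewrite ltr_pdivlMr ?ltr_wpDl // => bd.
  have [b0|b0] := ltP b 0; last by lra.
  by apply: (@le_trans _ _ 0); [rewrite mulr_ge0_le0 // ltW|lra].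
have pos (a : R) : 0 <= a -> 0 < d / 4 / (a + 1).
  by move=> a0; rewrite !divr_gt0 // ltr_wpDl.
have [S' SS' [K1 S'K]] := approx S _ (pos _ (normr_ge0 t)).
have [T' TT' [K2 T'K]] := approx T _ (pos _ (normr_ge0 S')).
exists (maxn K1 K2) => k; rewrite geq_max => /andP[K1k K2k].
have ST' := block_trace_comm (S'K k K1k) (T'K k K2k).
have stE : s * t = (s - S') * t + S' * (t - T') + S' * T'.
  by rewrite mulrBl mulrBr addrA !subrK.
have tsE : t * s = t * (s - S') + (t - T') * S' + T' * S'.
  by rewrite mulrBl mulrBr addrA !subrK.
have bound (A B : bop X p1) : `|A| * `|B| <= d / 4 ->
    normc (block_trace k (A * B)) <= (d / 4) *+ N k.
  move=> AB; apply: le_trans (block_trace_norm _ _) _.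
  by rewrite lerMn2r (le_trans (ler_bopM _ _)) ?orbT.
have b1 := small _ _ (normr_ge0 t) SS'.
have b2 := small _ _ (normr_ge0 S') TT'.
rewrite -[X in block_trace k X]/(s * t - t * s) block_traceD block_traceN stE tsE.
rewrite !block_traceD ST'.
have -> : forall a b c a' b' : R[i], a + b + c - (a' + b' + c) = a + b - (a' + b').
  by move=> *; ring.
have -> : d *+ N k = ((d / 4) *+ N k + (d / 4) *+ N k) +
   ((d / 4) *+ N k + (d / 4) *+ N k).
  by rewrite -!mulrnDl; congr (_ *+ _); field.
apply: le_trans (le_normcD _ _) _; rewrite normcN.
apply: lerD; apply: le_trans (le_normcD _ _) _; apply: lerD; apply: bound => //;
  by rewrite mulrC.
Qed.

Lemma block_trace_sum_comm (I : Type) (r : seq I)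
    (S T : I -> uniform_roe X p1) (d : R) : 0 < d ->
  exists K, forall k, (K <= k)%N ->
    normc (block_trace k ((\sum_(i <- r) (S i * T i - T i * S i)) : uniform_roe X p1))
      <= d *+ N k.
Proof.
elim: r d => [|i r ih] d d0.
  exists 0%N => k _; rewrite big_nil.
  rewrite (_ : block_trace k _ = 0) ?normc0 ?mulrn_wge0 ?ltW //.
  by rewrite /block_trace big1.
have d20 : 0 < d / 2 by rewrite divr_gt0.
have [K1 K1P] := ih _ d20; have [K2 K2P] := roe_trace_comm (S i) (T i) d20.
exists (maxn K1 K2) => k; rewrite geq_max => /andP[K1k K2k].
rewrite big_cons -[X in block_trace k X]/(uniform_roe_val (S i * T i - T i * S i) +
  uniform_roe_val (\sum_(j <- r) (S j * T j - T j * S j))) block_traceD.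
apply: le_trans (le_normcD _ _) _; rewrite [in leRHS](splitr d) mulrnDl.
by apply: lerD; [exact: K2P|exact: K1P].
Qed.

(** Otherwise n would be a sum of commutators, and the trace n N_k of n over the
first N_k points would be at most N_k / 2 for large k. *)
Lemma roe_K0_unit_torsion_free n :
  K0_unit (uniform_roe X p1) *+ n = 0 -> n = 0%N.
Proof.
move=> /K0_unit_commutators[r rn]; apply/eqP; rewrite -leqn0 leqNgt.
apply/negP => n0.
have d0 : 0 < 2^-1 :> R by rewrite invr_gt0.
have [K KP] := block_trace_sum_comm r fst snd d0.
have := KP K (leqnn K); rewrite rn.
have -> : block_trace K (n%:R : uniform_roe X p1) = (N K)%:R *+ n.
  elim: (n) => [|m ih]; first by rewrite /block_trace big1.
  by rewrite !mulrS -ih -block_trace1 -block_traceD.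
rewrite -mulrnA normc_nat -[leRHS]mulr_natr natrM mulrC.
rewrite ler_pM2r ?ltr0n ?block_gt0 // => h.
have : (1 : R) <= n%:R by rewrite ler1n.
lra.
Qed.

(** The residues modulo N_k cut X into N_k pieces, and subtracting the residue is
a partial bijection of each of them with the set of multiples of N_k, moving
points within their block only.  So 1 is an orthogonal sum of N_k idempotents, all
equivalent to the projection onto the multiples of N_k. *)
Lemma roe_K0_unit_divisible k : exists b, K0_unit (uniform_roe X p1) = b *+ N k.
Proof.
have [eb _ _ /(_ k)[r rN]] := eN; have [g eg ge] := eb.
set n := N k in rN *; have n0 : (0 < n)%N by exact: block_gt0.
pose f (i : 'I_n) x := if (g x %% n == i)%N then Some (e (g x - i)) else None.
pose h (i : 'I_n) x := if (n %| g x)%N then Some (e (g x + i)) else None.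
have fhP i x y : f i x = Some y <-> h i y = Some x.
  rewrite /f /h; split.
    case: eqP => // xi [<-]; rewrite eg.
    have -> : (g x - i = g x %/ n * n)%N by rewrite -xi {1}(divn_eq (g x) n) addnK.
    by rewrite dvdn_mull // -xi -divn_eq ge.
  case: ifP => // /dvdnP[m ym] [<-]; rewrite eg addnK ge.
  by rewrite ym modnMDl modn_small ?eqxx.
pose s i := PartialBij (fhP i).
have srP i x y : fwd (s i) x = Some y -> mdist x y <= r.
  rewrite /= /f; case: eqP => // xi [<-]; rewrite -{1}(ge x); apply: rN.
  by rewrite -xi {2}(divn_eq (g x) n) addnK mulnK.
have roe1 (t : partial_bij X X) : (forall x y, fwd t x = Some y -> mdist x y <= r) ->
    roundtrip p1 t partial_bij_id \in @roe_pred R X p p1.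
  move=> tr; apply: finite_propagation_roe; apply/finite_propagationP.
  exists r => a b /opcoef_roundtrip[y /= [<-]] /tr.
  by rewrite metric_sym.
have roe2 i : roundtrip p1 (partial_inv (s i)) partial_bij_id \in @roe_pred R X p p1.
  by apply: roe1 => x y /fwdP /srP; rewrite metric_sym.
pose u i := UniformRoe (roe2 i).
have roe3 i : roundtrip p1 (s i) partial_bij_id \in @roe_pred R X p p1.
  by apply: roe1 => x y; exact: srP.
pose v i := UniformRoe (roe3 i).
have vuE i j w x : (v i * u j) w x = if (i == j) && (n %| g x)%N then w x else 0.
  rewrite -[LHS]/(oapp (fun y => oapp w 0 (f j y)) 0 (h i x)) /f /h.
  case nx: (n %| g x)%N => /=; last by rewrite andbF.
  have gxi : ((g x + i) %% n)%N = i.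
    by move/dvdnP: nx => [m ->]; rewrite modnMDl modn_small.
  rewrite eg gxi andbT -val_eqE /=; case: eqP => [ij|//] /=.
  by rewrite -ij addnK ge.
pose i0 := Ordinal n0; pose q := v i0 * u i0.
apply: (@K0_unit_div _ n q u v).
- apply: roe_ext => w; apply/val_inj/funext => x.
  rewrite -[LHS]/((v i0 * u i0) ((v i0 * u i0) w) x).
  by rewrite -[RHS]/((v i0 * u i0) w x) !vuE; case: (_ && _).
- apply: roe_ext => w; rewrite roe_sumE.
  pose c x := Ordinal (ltn_pmod (g x) n0).
  have sc x i : isSome (fwd (s i) x) = (i == c x).
    by rewrite /= /f eq_sym -val_eqE /= eq_sym; case: eqP.
  by rewrite -[RHS](translate_cover sc); apply: eq_bigr => i _; apply/val_inj.
- move=> i j; apply: roe_ext => w; apply/val_inj/funext => x.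
  rewrite -[LHS]/((v i * u j) w x) vuE; case: eqP => //= _.
  by rewrite -[RHS]/((v i0 * u i0) w x) vuE eqxx.
Qed.

End Blocks.

(** * Coarse equivalence of spaces with nested blocks *)

Section BlocksCoarse.
Local Open Scope nat_scope.

Lemma same_block x x' n : 0 < n -> x <= x' ->
  (forall c, ~~ (x < c * n <= x')) -> x %/ n = x' %/ n.
Proof.
move=> n0 xx h; apply/eqP; rewrite eqn_leq leq_div2r //= leqNgt.
apply/negP => lt; have := h (x' %/ n).
by rewrite leq_trunc_div andbT -ltn_divLR // lt.
Qed.

Lemma block_split x x' c n : 0 < n -> x < c * n <= x' -> x %/ n <> x' %/ n.
Proof.
move=> n0 /andP[xc cx] e; have := leq_div2r n cx.
by rewrite mulnK // -e leqNgt ltn_divLR // xc.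
Qed.

Lemma floor_index (beta : nat -> nat) : beta 0 = 0 ->
  {homo beta : x y / x < y} ->
  exists f : nat -> nat, forall x, beta (f x) <= x < beta (f x).+1.
Proof.
move=> b0 bS.
suff /choice[f] : forall x, exists y, beta y <= x < beta y.+1 by exists f.
elim=> [|x [y /andP[yx xy]]].
  by exists 0; rewrite b0 leqnn -[X in X < _]b0 bS.
have [xy'|yx'] := ltnP x.+1 (beta y.+1); first by exists y; rewrite xy' leqW.
by exists y.+1; rewrite yx' (leq_ltn_trans xy) // bS.
Qed.

End BlocksCoarse.

(** The maps beta and f, where f x is the largest y with beta y <= x.  Suppose
that f x < j m_k <= f x'; then the multiple beta (j m_k) of n_k lies between x and
x', so that x and x' are in different n_k-blocks.  Dually, a multiple of n_(k+1)
between beta y and beta y' is the image of a multiple of m_k between y and y'. *)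
Lemma blocks_coarse (R : realType) (X Y : metricType R) eX N eY M :
  @block_enumeration R X eX N -> @block_enumeration R Y eY M ->
  coarsely_equivalent X Y.
Proof.
move=> XP YP.
have [[gX eXK gXK] NP XN NX] := XP; have [[gY eYK gYK] MP YM MY] := YP.
have [u [v [b [uS vS b0 bS [bd bh]]]]] := interleaving NP MP.
have N0 k : (0 < N k)%N by exact: divisor_chain_gt0.
have M0 k : (0 < M k)%N by exact: divisor_chain_gt0.
have [f fP] := floor_index b0 bS.
have b_le : {homo b : x y / (x <= y)%N}.
  by apply: ltnW_homo.
have f_le x y : (x <= y)%N -> (f x <= f y)%N.
  move=> xy; rewrite leqNgt; apply/negP => yx.
  have /andP[fx _] := fP x; have /andP[_ fy] := fP y.
  by have := leq_trans (leq_trans fy (b_le _ _ yx)) (leq_trans fx xy); rewrite ltnn.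
have fb y : f (b y) = y.
  have /andP[l1 l2] := fP (b y); apply/eqP; rewrite eqn_leq.
  apply/andP; split; rewrite leqNgt; apply/negP.
    by move=> /bS; rewrite ltnNge l1.
  by move=> /b_le /(leq_trans l2); rewrite ltnn.
have f_block k x x' : (x %/ N (u k) = x' %/ N (u k))%N ->
    (f x %/ M (v k) = f x' %/ M (v k))%N.
  wlog xx : x x' / (x <= x')%N.
    by move=> h; have [/h//|/ltnW/h xx /esym/xx] := leqP x x'.
  move=> e; apply: same_block => //; first exact: f_le.
  move=> c; apply/negP => /andP[fc cf].
  have /dvdnP[d dE] := bd k c.
  apply: (@block_split x x' d (N (u k))) e => //; rewrite -dE.
  have /andP[_ xf] := fP x; have /andP[fx' _] := fP x'.
  by rewrite (leq_trans xf (b_le _ _ fc)) (leq_trans (b_le _ _ cf)).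
have b_block k y y' : (y %/ M (v k) = y' %/ M (v k))%N ->
    (b y %/ N (u k.+1) = b y' %/ N (u k.+1))%N.
  wlog yy : y y' / (y <= y')%N.
    by move=> h; have [/h//|/ltnW/h yy /esym/yy] := leqP y y'.
  move=> e; apply: same_block => //; first exact: b_le.
  move=> c; apply/negP; have [j <-] := bh k c => /andP[yc cy].
  apply: (@block_split y y' j (M (v k))) e => //.
  rewrite !ltnNge; apply/andP; split; first by apply: contraL yc => /b_le; rewrite -leqNgt.
  by rewrite leqNgt; apply: contraL cy => /bS; rewrite -ltnNge.
have bf_block x : (b (f x) %/ N (u 1) = x %/ N (u 1))%N.
  have /andP[l1 l2] := fP x; apply: same_block => // c; apply/negP.
  have [j <-] := bh 0%N c => /andP[fj jx].
  have : (f x < j * M (v 0))%N by rewrite ltnNge; apply: contraL fj => /b_le; rewrite -leqNgt.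
  by move=> /b_le jf; have := leq_trans (leq_trans l2 jf) jx; rewrite ltnn.
have pos (r : R) : 0 < Num.max r 1 by rewrite lt_max ltr01 orbT.
exists (eY \o f \o gX), (eX \o b \o gY); split.
- move=> r _; have [k kP] := XN r; have [s sP] := MY (v k).
  exists (Num.max s 1) => // x x' xx; rewrite le_max sP //.
  apply: f_block; apply: (block_refine XP (leq_homo_ltn uS k)); apply: kP.
  by rewrite !gXK.
- move=> r _; have [k kP] := YM r; have [s sP] := NX (u k.+1).
  exists (Num.max s 1) => // y y' yy; rewrite le_max sP //.
  apply: b_block; apply: (block_refine YP (leq_homo_ltn vS k)); apply: kP.
  by rewrite !gYK.
- by exists 1 => // y /=; rewrite eXK fb gYK mdistxx.
- have [s sP] := NX (u 1%N); exists (Num.max s 1) => // x /=.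
  by rewrite eYK le_max -{2}(gXK x) sP.
Qed.

(** * Locally finite groups *)

Section GroupEnumeration.
Variables (R : realType) (G : metricGroupType R).
Local Open Scope group_scope.

Definition subgroup_set (H : set G) : Prop :=
  H 1 /\ forall x y, H x -> H y -> H (x^-1 * y).

Lemma subgroup_setV H x : subgroup_set H -> H x -> H x^-1.
Proof. by move=> [H1 HP] Hx; rewrite -[x^-1]mulg1; exact: HP. Qed.

Lemma subgroup_setM H x y : subgroup_set H -> H x -> H y -> H (x * y).
Proof. by move=> HP /(subgroup_setV HP) Hx; rewrite -[x]invgK; exact: HP.2. Qed.

Lemma subgroup_generatedP (S : set G) : subgroup_set (subgroup_generated S).
Proof.
have memE (H : set G) x : H x -> x \in mem H by move=> Hx; exact/mem_set.
split=> [H [/= [H1 _] _]|x y xS yS H [/= HP SH]].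
  exact: set_mem.
have [H1 Hdiv] := HP; have HV := group_closedV HP; have HM := group_closedM HP.
apply: set_mem; apply: HM; first by apply: HV; apply: memE; apply: xS.
by apply: memE; apply: yS.
Qed.

(** The list s is scanned, and an element is kept when its left coset is not yet
represented.  The unit comes first so that it represents H itself. *)
Lemma transversal (H : set G) (s : seq G) : subgroup_set H ->
  exists T : seq G, [/\ uniq T, head 1 T = 1, {subset T <= 1 :: s},
    (forall x y, x \in T -> y \in T -> H (x^-1 * y) -> x = y) &
    forall x, x \in 1 :: s -> exists2 t, t \in T & H (t^-1 * x)].
Proof.
move=> HP; elim/last_ind: s => [|s x [T [uT T1 Ts Tinj Tcov]]].
  exists [:: 1]; split => //.
    by move=> x y; rewrite !inE => /eqP -> /eqP ->.
  move=> x; rewrite inE => /eqP ->; exists 1; first exact: mem_head.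
  by rewrite mulVg; exact: HP.1.
have memr y : (y \in 1 :: rcons s x) = (y == x) || (y \in 1 :: s).
  by rewrite !inE mem_rcons inE orbCA.
have [[t tT tx]|no] := pselect (exists2 t, t \in T & H (t^-1 * x)).
  exists T; split => // [y yT|y]; rewrite memr; first by rewrite Ts ?orbT.
  by case/orP => [/eqP ->|/Tcov //]; exists t.
exists (rcons T x); split.
- rewrite rcons_uniq uT andbT; apply/negP => xT; apply: no; exists x => //.
  by rewrite mulVg; exact: HP.1.
- have [t tT _] := Tcov 1 (mem_head _ _).
  by move: T1 tT; case: (T).
- by move=> y; rewrite mem_rcons inE memr => /orP[->//|/Ts ->]; rewrite orbT.
- move=> y z; rewrite !mem_rcons !inE => /orP[/eqP ->|yT] /orP[/eqP ->|zT] //.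
  + move=> Hxz; case: no; exists z => //.
    by rewrite -[z^-1 * x]invgK invgM invgK; exact: subgroup_setV.
  + by move=> Hyx; case: no; exists y.
  + exact: Tinj.
- move=> y; rewrite memr => /orP[/eqP ->|/Tcov[t tT ty]].
    by exists x; rewrite ?mem_rcons ?mem_head // mulVg; exact: HP.1.
  by exists t => //; rewrite mem_rcons inE tT orbT.
Qed.

Definition enumerates (H : set G) (s : seq G) : Prop :=
  [/\ subgroup_set H, uniq s & forall x, (x \in s) <-> H x].

(** The list s' runs through the left cosets T_t s of H one after the other,
beginning with H itself. *)
Definition coset_refinement (H : set G) (s s' : seq G) : Prop :=
  exists T : seq G, [/\ (1 < size T)%N, size s' = (size T * size s)%N,
    prefix s s' &
    forall t i, (t < size T)%N -> (i < size s)%N ->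
      nth 1 s' (t * size s + i) = nth 1 T t * nth 1 s i /\
      forall t', (t' < size T)%N ->
        H ((nth 1 T t)^-1 * nth 1 T t') -> t = t'].

(** A left transversal T of H in H' that starts with 1, followed by s on each of
its cosets, enumerates H'. *)
Lemma enumerates_step (H H' : set G) (s : seq G) : enumerates H s -> subgroup_set H' ->
  finite_set H' -> H `<=` H' -> (exists2 x, H' x & ~ H x) ->
  exists2 s', enumerates H' s' & coset_refinement H s s'.
Proof.
move=> [HP us sH] HP' /finite_seqP[l lH] HH' [z Hz nz].
have lE x : (x \in l) <-> H' x by rewrite lH.
have [T [uT T1 Tl Tinj Tcov]] := transversal l HP.
have TH' t : t \in T -> H' t.
  by move=> /Tl; rewrite inE => /orP[/eqP ->|/lE //]; exact: HP'.1.
pose s' := flatten [seq [seq t * x | x <- s] | t <- T].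
have s'E x : (x \in s') <-> H' x.
  split=> [/flattenP[w /mapP[t tT ->] /mapP[y /sH Hy ->]]|Hx].
    by apply: (subgroup_setM HP'); [exact: TH'|exact: HH'].
  have [t tT tx] : exists2 t, t \in T & H (t^-1 * x).
    by apply: Tcov; rewrite inE (lE x).2 ?orbT.
  apply/flattenP; exists [seq t * x | x <- s]; first exact: map_f.
  by apply/mapP; exists (t^-1 * x); [exact/sH|rewrite mulVKg].
have sizes' : size s' = (size T * size s)%N.
  by rewrite /s' (size_flatten_const (s := size s)) ?size_map // => w /mapP[t _ ->];
     rewrite size_map.
have us' : uniq s'.
  apply: allpairs_uniq => // -[a b] [c d] /= /allpairsP[[a' b'] [/= aT bs [-> ->]]].
  move=> /allpairsP[[c' d'] [/= cT ds [-> ->]]] e.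
  have ac : a' = c'.
    apply: Tinj => //; have -> : a'^-1 * c' = b' * d'^-1.
      by apply: (mulgI a'); rewrite mulVKg mulgA e mulgK.
    by apply: (subgroup_setM HP); [exact/sH|apply: (subgroup_setV HP); exact/sH].
  by move: e; rewrite ac => /mulgI ->.
have [t1 t1T t1H] := Tcov 1 (mem_head _ _).
have T1' : exists T', T = 1 :: T'.
  by move: T1 t1T; case: (T) => [|a T'] //= -> _; exists T'.
exists s' => //; exists T; split => //.
- have [T' TE] := T1'; rewrite TE /= ltnS; case: T' TE => [|//] TE.
  have [t] : exists2 t, t \in T & H (t^-1 * z).
    by apply: Tcov; rewrite inE (lE z).2 ?orbT.
  by rewrite TE inE => /eqP ->; rewrite invg1 mul1g.
- have [T' TE] := T1'; rewrite /s' TE /=.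
  by rewrite (eq_map (g := id)) ?map_id ?prefix_prefix // => x; rewrite mul1g.
- move=> t i tT iS; split; last first.
    move=> t' t'T /Tinj e; apply/eqP; rewrite -(nth_uniq 1 tT t'T uT); apply/eqP.
    by apply: e; exact: mem_nth.
  rewrite /s'; elim: (T) t tT => // a T' ih [|t] tT /=.
    by rewrite nth_cat size_map iS (nth_map 1).
  rewrite nth_cat size_map mulSn -addnA ltnNge leq_addr /= addKn; exact: ih.
Qed.

Hypotheses (G_lf : locally_finite G) (G_proper : proper_metric G)
  (G_inv : left_invariant_metric G) (G_inf : ~ finite_set [set: G]).

(** H' is generated by H, a ball, and one point outside H: it is finite because G
is locally finite and its balls are finite, and larger than H because G is
infinite. *)
Lemma subgroup_step k (H : set G) (s : seq G) : enumerates H s ->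
  exists (H' : set G) s', [/\ forall x : G, mdist 1 x <= k%:R -> H' x,
    enumerates H' s' & coset_refinement H s s'].
Proof.
move=> HS; have [HP us sH] := HS.
have Hfin : finite_set H.
  by apply/finite_seqP; exists s; apply/seteqP; split => x /sH.
have [z nz] : exists z, ~ H z.
  apply: contrapT => no; apply: G_inf; apply: sub_finite_set Hfin => x _.
  by apply: contrapT => nx; apply: no; exists x.
pose S := H `|` [set y : G | mdist 1 y <= k%:R] `|` [set z].
have Sgen : S `<=` subgroup_generated S by exact: sub_gen_smallest.
have [s' s's ss'] : exists2 s', enumerates (subgroup_generated S) s' &
    coset_refinement H s s'.
  apply: (enumerates_step HS).
  - exact: subgroup_generatedP.
  - by apply: G_lf; rewrite !finite_setU; split=> //; split=> //; exact: G_proper.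
  - by move=> x Hx; apply: Sgen; left; left.
  - by exists z => //; apply: Sgen; right.
exists (subgroup_generated S), s'; split => // x xk.
by apply: Sgen; left; right.
Qed.

(** A chain of finite subgroups exhausting the balls, enumerated so that each
enumeration continues the previous one coset by coset: two elements lie in the
same left coset of the k-th subgroup exactly when their indices lie in the same
block of length N_k.  By left invariance the distance of x and y depends only on
x^-1 y, so that bounded distance amounts to a common coset. *)
Lemma group_block_enumeration : exists e N, @block_enumeration R G e N.
Proof.
have enumerates1 : enumerates [set 1] [:: 1].
  split=> //; last by move=> x; rewrite inE; split=> [/eqP|/= ->].
  by split => // x y -> ->; rewrite /= mulVg.
pose P (k : nat) (x y : set G * seq G) := enumerates x.1 x.2 ->
  [/\ forall z : G, mdist 1 z <= k%:R -> y.1 z, enumerates y.1 y.2 &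
    coset_refinement x.1 x.2 y.2].
have /choice[step stepP] : forall kx : nat * (set G * seq G),
    exists y, P kx.1 kx.2 y.
  move=> [k [H s]]; have [HS|nHS] := pselect (enumerates H s); last by exists (H, s).
  by have [H' [s' HS']] := subgroup_step k HS; exists (H', s').
pose st := fix st k := if k is k'.+1 then step (k', st k') else ([set 1], [:: 1]).
pose H k := (st k).1; pose s k := (st k).2; pose N k := size (s k).
have HS k : enumerates (H k) (s k).
  elim: k => [|k ih]; first exact: enumerates1.
  by have [] := stepP (k, st k) ih.
have stP k : P k (st k) (st k.+1) := stepP (k, st k).
have NP : divisor_chain N.
  split=> // k; have [_ _ [T [T1 sT _ _]]] := stP k (HS k).
  by exists (size T).
have pre k l : (k <= l)%N -> prefix (s k) (s l).
  move=> kl; rewrite -(subnKC kl); elim: (l - k)%N => [|d ih].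
    by rewrite addn0 prefix_refl.
  rewrite addnS; apply: prefix_trans ih _.
  by have [_ _ [T []]] := stP (k + d)%N (HS _).
have N_gt k : (k < N k)%N by exact: divisor_chain_gt.
have HSP k := let: And3 h _ _ := HS k in h.
have Hle k l : (k <= l)%N -> H k `<=` H l.
  by move=> kl x; have [_ _ sk] := HS k; have [_ _ sl] := HS l;
    move=> /sk xk; apply/sl; have /prefixP[w ->] := pre _ _ kl; rewrite mem_cat xk.
(* By induction on l: an index below N_(l+1) splits into the number of its
   coset and its place in that coset. *)
have block k l i j : (k <= l)%N -> (i < N l)%N -> (j < N l)%N ->
    H k ((nth 1 (s l) i)^-1 * nth 1 (s l) j) <-> (i %/ N k = j %/ N k)%N.
  move=> kl; rewrite -(subnKC kl); elim: (l - k)%N i j => [|d ih] i j.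
    rewrite addn0 => ik jk; rewrite !divn_small //; split=> // _.
    have [HP _ sk] := HS k.
    by apply: HP.2; apply/sk; exact: mem_nth.
  rewrite addnS; set m := (k + d)%N in ih *.
  have [_ _ [T [T1 sT _ TP]]] := stP m (HS m).
  have N0 : (0 < N m)%N by exact: leq_ltn_trans (N_gt m).
  have -> : N m.+1 = (size T * N m)%N by [].
  rewrite -!ltn_divLR // => iT jT.
  rewrite {1}(divn_eq i (N m)) {1}(divn_eq j (N m)).
  have [-> inj] := TP _ _ iT (ltn_pmod i N0).
  have [-> _] := TP _ _ jT (ltn_pmod j N0).
  have /dvdnP[b bE] := divisor_chain_dvd NP (leq_addr d k : (k <= m)%N).
  rewrite invgM -/(s m).
  set x := nth 1 (s m) _; set y := nth 1 (s m) (j %% _).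
  have Hx : H m x by have [_ _ h] := HS m; apply/h/mem_nth/ltn_pmod.
  have Hy : H m y by have [_ _ h] := HS m; apply/h/mem_nth/ltn_pmod.
  have NkN : (0 < N k)%N by exact: leq_ltn_trans (N_gt k).
  have divE a : (a %/ N k = a %/ N m * b + (a %% N m) %/ N k)%N.
    by rewrite {1}(divn_eq a (N m)) bE mulnA divnMDl // -bE.
  rewrite (divE i) (divE j).
  have [tt|tt] := eqVneq (i %/ N m)%N (j %/ N m)%N.
    rewrite tt -mulgA mulKg ih ?ltn_pmod //.
    by split=> [->//|/addnI].
  split=> [Hk|e].
    case/eqP: tt; apply: inj => //.
    have := subgroup_setM (HSP m) (subgroup_setM (HSP m) Hx (Hle _ _ (leq_addr d k) _ Hk))
      (subgroup_setV (HSP m) Hy).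
    by rewrite !mulgA mulgK mulgV mul1g.
  have b0 : (0 < b)%N by case: (b) bE N0 => // ->.
  have small a : ((a %% N m) %/ N k < b)%N by rewrite ltn_divLR // -bE ltn_pmod.
  case/eqP: tt; have := congr1 (fun c => c %/ b)%N e.
  by rewrite !divnMDl // !(divn_small (small _)) !addn0.
pose e i := nth 1 (s i) i.
have eE i k : (i < N k)%N -> e i = nth 1 (s k) i.
  move=> ik; have [/pre/prefixP[w wE]|/ltnW/pre/prefixP[w wE]] := leqP i k.
    by rewrite /e wE nth_cat N_gt.
  by rewrite /e wE nth_cat -/(N k) ik.
have eblock k i j : H k ((e i)^-1 * e j) <-> (i %/ N k = j %/ N k)%N.
  pose l := maxn k (maxn i j).
  have il : (i < N l)%N by rewrite (leq_ltn_trans _ (N_gt l)) // !leq_max leqnn orbT.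
  have jl : (j < N l)%N by rewrite (leq_ltn_trans _ (N_gt l)) // !leq_max leqnn !orbT.
  by rewrite (eE i l) // (eE j l) // block // leq_maxl.
have ball k (x : G) : mdist 1 x <= k%:R -> H k.+1 x.
  by have [h _ _] := stP k (HS k); exact: h.
have nat_ge (r : R) : exists k : nat, r <= k%:R.
  by exists (Num.truncn `|r|).+1; rewrite (le_trans (ler_norm r)) // ltW // truncnS_gt.
have dE x y : mdist (x : G) y = mdist 1 (x^-1 * y).
  by rewrite -(G_inv x^-1) mulVg.
have e_inj : injective e.
  move=> i j ij; have := (eblock 0%N i j).1.
  by rewrite ij mulVg !divn1; apply.
have e_surj x : exists i, e i = x.
  have [k kx] := nat_ge (mdist 1 x).
  have [_ _ h] := HS k.+1; have xs := (h x).2 (ball k x kx).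
  by exists (index x (s k.+1)); rewrite (eE _ k.+1) ?nth_index // /N index_mem.
exists e, N; split => //.
- have /choice[g gP] := e_surj; exists g => // i.
  by apply: e_inj; rewrite gP.
- move=> r; have [k kr] := nat_ge r; exists k.+1 => i j ij.
  by apply/eblock/ball; rewrite -dE (le_trans ij).
- move=> k; exists (\sum_(x <- s k) mdist (1%g : G) x)%R => i j /eblock.
  have [_ _ h] := HS k; move=> /h xs; rewrite dE.
  rewrite (big_rem _ xs) /= lerDl; apply: sumr_ge0 => x _; exact: mdist_ge0.
Qed.

End GroupEnumeration.

(** Two points of a fibre of f are at distance at most 2r from one another.  So x
is determined by f x and by the quotient of x by a chosen point of its fibre,
which lies in a fixed finite ball and serves as colour. *)
Lemma fibre_colouring (R : realType) (G : metricGroupType R) (Y : metricType R)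
    (f : G -> Y) (g : Y -> G) : proper_metric G -> left_invariant_metric G ->
  close_maps (g \o f) id ->
  exists (n : nat) (c : G -> 'I_n), forall x x', f x = f x' -> c x = c x' -> x = x'.
Proof.
move=> G_proper G_inv [r r0 gfr].
have /finite_seqP[s sP] := G_proper 1%g (2 * r).
have sE (y : G) : (y \in s) = (mdist 1%g y <= 2 * r).
  apply/idP/idP => [ys|yr]; last by have : [set` s] y by rewrite -sP.
  by have : [set` s] y by []; rewrite -sP.
pose b (y : Y) : G := xget 1%g [set x | f x = y].
have bP x : f (b (f x)) = f x by apply: (@xgetPex _ 1%g [set z | f z = f x]); exists x.
exists (size s).+1, (fun x => inord (index ((b (f x))^-1 * x)%g s)) => x x' ff.
have near z : ((b (f z))^-1 * z)%g \in s.
  rewrite sE -[X in mdist X _](mulVg (b (f z))) G_inv.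
  apply: le_trans (metric_triangle _ (g (f z)) _) _.
  rewrite [_ * r]mulrDl mul1r lerD //; last exact: gfr.
  by rewrite metric_sym -{1}(bP z); exact: gfr.
move=> /(congr1 val); rewrite /= !inordK ?ltnS ?index_size // => ii.
have := congr1 (nth 1%g s) ii; rewrite !nth_index ?near // ff.
exact: mulgI.
Qed.

Lemma finite_group_K0 (R : realType) (G : metricGroupType R) (p : R)
    (p1 : 1 <= p) : finite_set [set: G] ->
  isomorphic_groups (K0 (uniform_roe G p1)) (K0 R[i]).
Proof.
move=> /finite_seqP[s sP].
have sE (x : G) : x \in undup s.
  by rewrite mem_undup; have : [set: G] x by []; rewrite sP.
pose e (i : 'I_(size (undup s))) := nth 1%g (undup s) i.
apply: (@finite_space_K0 R p p1 G _ e 1%g).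
exists (fun x => Ordinal (etrans (index_mem x (undup s)) (sE x))) => [i|x].
  by apply: val_inj; rewrite /= index_uniq ?undup_uniq.
by rewrite /e /= nth_index.
Qed.

(** The class of the unit is nonzero and divisible by the orders of all finite
subgroups of a chain. *)
Lemma infinite_group_K0 (R : realType) (G : metricGroupType R) (p : R)
    (p1 : 1 <= p) : locally_finite G -> proper_metric G ->
  left_invariant_metric G -> ~ finite_set [set: G] ->
  ~ isomorphic_groups (K0 (uniform_roe G p1)) (K0 R[i]).
Proof.
move=> Glf Gp Gi Ginf iso.
have [e [N eN]] := group_block_enumeration Glf Gp Gi Ginf.
have : K0_unit (uniform_roe G p1) = 0.
  apply: (infinitely_divisible_iso iso (@K0_field_not_divisible _)) => n.
  exists (N n); last exact: roe_K0_unit_divisible eN _ _ _.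
  by have [_ NP _ _] := eN; exact/ltnW/divisor_chain_gt.
by move=> /(roe_K0_unit_torsion_free eN (n := 1)).
Qed.

Lemma isomorphic_groups_trans (U V W : zmodType) :
  isomorphic_groups U V -> isomorphic_groups V W -> isomorphic_groups U W.
Proof.
move=> [f fb] [g gb]; exists (g \o f : {additive U -> W}).
exact: bij_comp.
Qed.

Lemma finite_groups_coarse (R : realType) (G L : metricGroupType R) :
  finite_set [set: G] -> finite_set [set: L] -> coarsely_equivalent G L.
Proof.
have bounded (H : metricGroupType R) : finite_set [set: H] ->
    exists2 r : R, 0 < r & forall x y : H, mdist x y <= r.
  move=> /finite_seqP[s sP]; have sE (x : H) : x \in s.
    by have : [set: H] x by []; rewrite sP.
  exists (1 + \sum_(x <- s) \sum_(y <- s) mdist x y) => [|x y].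
    rewrite ltr_wpDr ?ltr01 // sumr_ge0 // => x _.
    by rewrite sumr_ge0 // => y _; exact: mdist_ge0.
  rewrite (big_rem x) //= (big_rem y) //= addrCA -addrA lerDl.
  rewrite !addr_ge0 // ?sumr_ge0 // => z _; first exact: mdist_ge0.
  by rewrite sumr_ge0 // => w _; exact: mdist_ge0.
move=> /bounded[r r0 rP] /bounded[s s0 sP].
exists (fun=> 1%g), (fun=> 1%g); split.
- by move=> ? _; exists s.
- by move=> ? _; exists r.
- by exists s.
- by exists r.
Qed.

Theorem corollaryF (R : realType) (G L : metricGroupType R)
    (G_countable : countable [set: G]) (L_countable : countable [set: L])
    (G_locally_finite : locally_finite G) (L_locally_finite : locally_finite L)
    (G_proper : proper_metric G) (L_proper : proper_metric L)
    (G_invariant : left_invariant_metric G)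
    (L_invariant : left_invariant_metric L) :
  [<-> coarsely_equivalent G L;
       forall (p : R) (p1 : 1 <= p),
         isomorphic_groups (K0 (uniform_roe G p1)) (K0 (uniform_roe L p1));
       exists (p : R) (p1 : 1 <= p),
         isomorphic_groups (K0 (uniform_roe G p1)) (K0 (uniform_roe L p1))].
Proof.
tfae.
- move=> [f [g [fe ge fg gf]]] p p1.
  have [n [c cP]] := fibre_colouring G_proper G_invariant gf.
  have [m [d dP]] := fibre_colouring L_proper L_invariant fg.
  exact: coarse_K0 fe ge fg gf cP dP.
- by move=> iso; exists 1, (lexx 1); exact: iso.
- move=> [p [p1 iso]].
  have [Gf|Gi] := pselect (finite_set [set: G]);
    have [Lf|Li] := pselect (finite_set [set: L]).
  + exact: finite_groups_coarse.
  + case: (infinite_group_K0 (p1 := p1) L_locally_finite L_proper L_invariant Li).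
    apply: isomorphic_groups_trans (isomorphic_groups_sym iso) _.
    exact: finite_group_K0.
  + case: (infinite_group_K0 (p1 := p1) G_locally_finite G_proper G_invariant Gi).
    by apply: isomorphic_groups_trans iso _; exact: finite_group_K0.
  + have [e [N eN]] := group_block_enumeration G_locally_finite G_proper G_invariant Gi.
    have [e' [N' eN']] := group_block_enumeration L_locally_finite L_proper L_invariant Li.
    exact: blocks_coarse eN eN'.
Qed.
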